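(* Let $T$ be an unbounded densely defined closed operator on a Hilbert space $H$. There is a unique bounded deformation $\{T_t\}_{t\in[0,1)}$ of $T$ such that, with $\tilde p_t=P_{\mathrm{Gr}(T_t)}$ for $t\in[0,1)$, \begin{enumerate} \item $T_0=0$; \item $t\mapsto\tilde p_t$, $t\in[0,1]$, is a geodesic in the Riemann sphere $\mathcal{R}$ of $B(H)$; \item $\tilde p_1=P_{\mathrm{Gr}(T)}$. \end{enumerate}
   Context: $\mathrm{Gr}(S)=\{(h,Sh):h\in\operatorname{Dom}(S)\}\subset H\times H$ and $P_{\mathrm{Gr}(S)}$ is the orthogonal projection onto it. The Riemann sphere of $B(H)$ is $\mathcal{R}=\{\tilde u\tilde p_0\tilde u^*:\tilde u\text{ unitary in }B(H\oplus H)\}$, $\tilde p_0=\begin{pmatrix}1&0\\0&0\end{pmatrix}$; it contains $P_{\mathrm{Gr}(S)}$ for every densely defined closed $S$. Its tangent space at $\tilde p$ is $(T\mathcal{R})_{\tilde p}=\{X\in B(H\oplus H):X^*=X,\ X\tilde p+\tilde pX=X\}$, with Finsler norm the operator norm; the length of a curve is $\int\|\dot\gamma\|\,dt$ and $\operatorname{dist}$ is the infimum of lengths of curves in $\mathcal{R}$ with given endpoints. Geodesics are the curves $\gamma(t)=e^{t\tilde X}\tilde pe^{-t\tilde X}$, $X\in(T\mathcal{R})_{\tilde p}$, $\tilde X=X\tilde p-\tilde pX$. A bounded deformation of an unbounded closed operator $T$ is a family $\{T_t\}_{t\in[0,\alpha)}$, $\alpha>0$, of bounded operators on $H$ such that $t\mapsto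 T_t$ is norm continuous and $\lim_{t\to\alpha^-}P_{\mathrm{Gr}(T_t)}=P_{\mathrm{Gr}(T)}$ in the Finsler metric of $\mathcal{R}$. For such a family one writes $\tilde p_t=P_{\mathrm{Gr}(T_t)}$, and $\tilde p_\alpha$ for its limit point. *)

(* Defs.v *)
From HB Require Import structures.
From mathcomp Require Import all_boot all_order all_algebra sesquilinear.
From mathcomp Require Import all_classical all_reals all_analysis.
From mathcomp Require Import ring.
From mathcomp.real_closed Require Import complex.

Set Implicit Arguments.
Unset Strict Implicit.
Unset Printing Implicit Defensive.

Import Order.TTheory GRing.Theory Num.Theory.
Import numFieldNormedType.Exports.

Local Open Scope classical_set_scope.
Local Open Scope ring_scope.
Local Open Scope complex_scope.

Local Notation Re := complex.Re.

(** [inner] is linear in its first argument and conjugate-linear in its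
second. *)

HB.mixin Record NormedModule_isHilbert (R : realType) H
    & NormedModule R[i] H := {
  inner : {dot H for (@Num.conj R[i] : R[i] -> R[i])} ;
  sqr_norm_inner : forall x : H, `|x| ^+ 2 = inner x x
}.

#[short(type="hilbertType")]
HB.structure Definition Hilbert (R : realType) :=
  {H of CompleteNormedModule R[i] H & NormedModule_isHilbert R H}.

(* The norm of an [R[i]]-module is [R[i]]-valued; [hnorm] is the same norm with
   values in [R]. *)
Definition hnorm {R : realType} {H : normedModType R[i]} (x : H) : R :=
  Re `|x|.

Section hnorm_theory.
Context {R : realType} {H : normedModType R[i]}.
Implicit Types x y : H.

Lemma hnormE x : `|x| = (hnorm x)%:C.
Proof. by rewrite /hnorm RRe_real // normr_real. Qed.

Lemma hnorm_ge0 x : 0 <= hnorm x.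
Proof. by have := normr_ge0 x; rewrite hnormE ler0c. Qed.

Lemma hnormZ a x : hnorm (a *: x) = Re `|a| * hnorm x.
Proof.
apply/complexI; rewrite -hnormE normrZ hnormE rmorphM/= RRe_real // normr_real.
Qed.

Lemma hnormZr (r : R) x : hnorm (r%:C *: x) = `|r| * hnorm x.
Proof. by rewrite hnormZ normc_def/= expr0n/= addr0 sqrtr_sqr. Qed.

Lemma hnormD x y : hnorm (x + y) <= hnorm x + hnorm y.
Proof. by rewrite -lecR rmorphD/= -!hnormE ler_normD. Qed.

Lemma hnorm0 : hnorm (0 : H) = 0.
Proof. by rewrite /hnorm normr0. Qed.

Lemma hnorm0_eq0 x : hnorm x = 0 -> x = 0.
Proof. by move=> x0; apply/normr0_eq0; rewrite hnormE x0. Qed.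

End hnorm_theory.

(** Hilbert direct sum.  An alias of the product is needed because the library
equips [H1 * H2] with the max norm. *)

Definition hsum {R : realType} (H1 H2 : hilbertType R) : Type := (H1 * H2)%type.

Section hsum.
Context {R : realType} {H1 H2 : hilbertType R}.
Local Notation K := (hsum H1 H2).

HB.instance Definition _ := GRing.Lmodule.copy K (H1 * H2)%type.

Definition hsum_norm (z : K) : R[i] :=
  (Num.sqrt (hnorm z.1 ^+ 2 + hnorm z.2 ^+ 2))%:C.

Lemma minkowski2 (a b c d : R) :
  Num.sqrt ((a + c) ^+ 2 + (b + d) ^+ 2) <=
  Num.sqrt (a ^+ 2 + b ^+ 2) + Num.sqrt (c ^+ 2 + d ^+ 2).
Proof.
have s0 x y : 0 <= x ^+ 2 + y ^+ 2 :> R by rewrite addr_ge0 ?sqr_ge0.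
rewrite -(@ler_pXn2r _ 2) ?nnegrE ?addr_ge0 ?sqrtr_ge0//.
rewrite sqr_sqrtr// [leRHS]sqrrD !sqr_sqrtr// -sqrtrM//.
set s := Num.sqrt _.
have : a * c + b * d <= s.
  rewrite (le_trans (ler_norm _))// -sqrtr_sqr ler_wsqrtr//.
  rewrite -subr_ge0.
  have -> : (a ^+ 2 + b ^+ 2) * (c ^+ 2 + d ^+ 2) - (a * c + b * d) ^+ 2 =
     (a * d - b * c) ^+ 2 by ring.
  exact: sqr_ge0.
move=> h; rewrite -subr_ge0.
have -> : a ^+ 2 + b ^+ 2 + s *+ 2 + (c ^+ 2 + d ^+ 2) -
  ((a + c) ^+ 2 + (b + d) ^+ 2) = (s - (a * c + b * d)) *+ 2.
  by ring.
by rewrite mulrn_wge0 ?subr_ge0.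
Qed.

Lemma hsum_normD z w : hsum_norm (z + w) <= hsum_norm z + hsum_norm w.
Proof.
rewrite /hsum_norm -rmorphD/= lecR (le_trans _ (minkowski2 _ _ _ _))//.
rewrite ler_wsqrtr// lerD// ler_pXn2r ?nnegrE ?addr_ge0 ?hnorm_ge0 ?hnormD//.
Qed.

Lemma hsum_normZ (a : R[i]) z : hsum_norm (a *: z) = `|a| * hsum_norm z.
Proof.
have a0 : 0 <= Re `|a| by rewrite normc_def sqrtr_ge0.
have -> : `|a| = (Re `|a|)%:C by rewrite RRe_real ?normr_real.
rewrite /hsum_norm -rmorphM/= !hnormZ !exprMn -mulrDr sqrtrM ?sqr_ge0//.
by rewrite sqrtr_sqr (ger0_norm a0).
Qed.

Lemma hsum_norm_eq0 z : hsum_norm z = 0 -> z = 0.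
Proof.
case: z => x y /complexI/eqP; rewrite sqrtr_eq0/= => h.
have /andP[] : (hnorm x ^+ 2 == 0) && (hnorm y ^+ 2 == 0).
  by rewrite -paddr_eq0 ?sqr_ge0// eq_le h addr_ge0 ?sqr_ge0.
by rewrite !sqrf_eq0 => /eqP/hnorm0_eq0 -> /eqP/hnorm0_eq0 ->.
Qed.

HB.instance Definition _ := Lmodule_isNormed.Build R[i] K
  hsum_normD hsum_normZ hsum_norm_eq0.

Lemma hsum_normE (z : K) : `|z| = hsum_norm z. Proof. by []. Qed.

Lemma hsum_norm_fst (z : K) : `|z.1| <= `|z|.
Proof.
rewrite hsum_normE /hsum_norm hnormE lecR -{1}(ger0_norm (hnorm_ge0 z.1)).
by rewrite -sqrtr_sqr ler_wsqrtr// lerDl sqr_ge0.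
Qed.

Lemma hsum_norm_snd (z : K) : `|z.2| <= `|z|.
Proof.
rewrite hsum_normE /hsum_norm hnormE lecR -{1}(ger0_norm (hnorm_ge0 z.2)).
by rewrite -sqrtr_sqr ler_wsqrtr// lerDr sqr_ge0.
Qed.

Lemma hsum_norm_le (z : K) : `|z| <= `|z.1| + `|z.2|.
Proof.
rewrite hsum_normE /hsum_norm !hnormE -rmorphD/= lecR.
have h0 : 0 <= hnorm z.1 + hnorm z.2 by rewrite addr_ge0 ?hnorm_ge0.
rewrite -[leRHS]ger0_norm// -sqrtr_sqr ler_wsqrtr// sqrrD.
by rewrite addrAC lerDl mulrn_wge0// mulr_ge0 ?hnorm_ge0.
Qed.

Lemma hsum_complete (F : set_system K) :
  ProperFilter F -> cauchy F -> cvg F.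
Proof.
move=> FF /cauchy_ballP Fc.
have c1 : cvg ((fst : K -> H1) @ F).
  apply: cauchy_cvg; apply/cauchy_ballP => e e0.
  have [[A B] /= [FA FB] AB] := Fc e e0.
  exists ((fst : K -> H1) @` A, (fst : K -> H1) @` B) => /=.
    by split; [apply: filterS FA|apply: filterS FB] => z Az; exists z.
  move=> [_ _] /= [[z Az <-] [w Bw <-]].
  have := AB (z, w) (conj Az Bw); rewrite -!ball_normE/= => /le_lt_trans; apply.
  exact: (hsum_norm_fst (z - w)).
have c2 : cvg ((snd : K -> H2) @ F).
  apply: cauchy_cvg; apply/cauchy_ballP => e e0.
  have [[A B] /= [FA FB] AB] := Fc e e0.
  exists ((snd : K -> H2) @` A, (snd : K -> H2) @` B) => /=.
    by split; [apply: filterS FA|apply: filterS FB] => z Az; exists z.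
  move=> [_ _] /= [[z Az <-] [w Bw <-]].
  have := AB (z, w) (conj Az Bw); rewrite -!ball_normE/= => /le_lt_trans; apply.
  exact: (hsum_norm_snd (z - w)).
apply/cvg_ex; exists ((lim ((fst : K -> H1) @ F), lim ((snd : K -> H2) @ F)) : K).
apply/cvgrPdist_lt => e e0.
have e20 : 0 < e / 2 by rewrite divr_gt0.
near=> z.
rewrite (le_lt_trans (hsum_norm_le _))// [ltRHS]splitr ltrD//=.
  by near: z; move/cvgrPdist_lt : c1; apply.
by near: z; move/cvgrPdist_lt : c2; apply.
Unshelve. all: by end_near. Qed.

HB.instance Definition _ := Uniform_isComplete.Build K hsum_complete.

Definition hsum_inner (z w : K) : R[i] := inner z.1 w.1 + inner z.2 w.2.

Lemma hsum_inner_bilinear :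
  bilinear_for *%R ((@Num.conj R[i] : R[i] -> R[i]) \; *%R) hsum_inner.
Proof.
split=> [w a u v|w a u v]; rewrite /hsum_inner/=.
  by rewrite !linearPl mulrDr addrACA.
by rewrite !linearP/= mulrDr addrACA.
Qed.

HB.instance Definition _ := bilinear_isBilinear.Build R[i] K K R[i]
  *%R ((@Num.conj R[i] : R[i] -> R[i]) \; *%R) hsum_inner hsum_inner_bilinear.

Lemma hsum_inner_herm z w :
  hsum_inner z w = (-1) ^+ false * Num.conj (hsum_inner w z).
Proof.
have hC (H : hilbertType R) (x y : H) : inner x y = Num.conj (inner y x).
  by rewrite (hermC inner) expr0 mul1r.
by rewrite /hsum_inner expr0 mul1r rmorphD/= -!hC.
Qed.

HB.instance Definition _ := isHermitianSesquilinear.Build R[i] K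
  false (@Num.conj R[i] : R[i] -> R[i]) hsum_inner hsum_inner_herm.

Lemma hsum_sqr_norm (z : K) : `|z| ^+ 2 = hsum_inner z z.
Proof.
rewrite hsum_normE /hsum_norm -rmorphXn/= sqr_sqrtr ?addr_ge0 ?sqr_ge0//.
by rewrite rmorphD/= !rmorphXn/= -!hnormE !sqr_norm_inner.
Qed.

Lemma hsum_inner_gt0 z : z != 0 -> 0 < hsum_inner z z.
Proof. by move=> z0; rewrite -hsum_sqr_norm exprn_gt0// normr_gt0. Qed.

HB.instance Definition _ := isDotProduct.Build R[i] K hsum_inner hsum_inner_gt0.

HB.instance Definition _ := NormedModule_isHilbert.Build R K hsum_sqr_norm.

End hsum.

(** Bounded operators.  [bop H] is a normed module over [R] rather than [R[i]],
so that the library's derivatives apply to curves [R -> bop H]. *)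

Record bop {R : realType} (H : hilbertType R) := BOp {
  bop_fun :> H -> H ;
  bop_linear : linear bop_fun ;
  bop_bounded : exists M : R, forall x, hnorm (bop_fun x) <= M * hnorm x
}.

HB.instance Definition _ (R : realType) (H : hilbertType R) (A : bop H) :=
  GRing.isLinear.Build R[i] H H *:%R A (@bop_linear R H A).

HB.instance Definition _ (R : realType) (H : hilbertType R) :=
  gen_eqMixin (bop H).
HB.instance Definition _ (R : realType) (H : hilbertType R) :=
  gen_choiceMixin (bop H).

Section bop.
Context {R : realType} {H : hilbertType R}.
Implicit Types (A B : bop H) (r : R).

Lemma bop_ext A B : A =1 B -> A = B.
Proof.
case: A B => [f lf bf] [g lg bg] /= /funext fg; subst g.
by congr BOp; exact: Prop_irrelevance.
Qed.

Lemma bop_bounded_gt0 A :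
  exists2 M : R, 0 < M & forall x, hnorm (A x) <= M * hnorm x.
Proof.
have [M AM] := bop_bounded A; exists (Num.max M 1).
  by rewrite lt_max ltr01 orbT.
by move=> x; rewrite (le_trans (AM x))// ler_wpM2r ?hnorm_ge0// le_max lexx.
Qed.

Lemma id_bop_subproof : exists M : R, forall x : H, hnorm (idfun x) <= M * hnorm x.
Proof. by exists 1 => x; rewrite mul1r. Qed.

Definition id_bop := BOp (@linearP _ _ _ _ (@idfun H)) id_bop_subproof.

Lemma comp_bop_subproof A B :
  exists M : R, forall x, hnorm ((A \o B) x) <= M * hnorm x.
Proof.
have [M M0 AM] := bop_bounded_gt0 A; have [N _ BN] := bop_bounded_gt0 B.
exists (M * N) => x; rewrite (le_trans (AM _))// -mulrA ler_wpM2l ?BN//.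
exact: ltW.
Qed.

Definition comp_bop A B := BOp (@linearP _ _ _ _ (A \o B)) (comp_bop_subproof A B).

Lemma zero_bop_subproof :
  exists M : R, forall x : H, hnorm ((\0 : H -> H) x) <= M * hnorm x.
Proof. by exists 0 => x; rewrite hnorm0 mul0r. Qed.

Definition zero_bop := BOp (@linearP _ _ _ _ (\0 : H -> H)) zero_bop_subproof.

Lemma add_bop_subproof A B :
  exists M : R, forall x, hnorm ((A \+ B) x) <= M * hnorm x.
Proof.
have [M _ AM] := bop_bounded_gt0 A; have [N _ BN] := bop_bounded_gt0 B.
by exists (M + N) => x; rewrite mulrDl (le_trans (hnormD _ _))// lerD.
Qed.

Definition add_bop A B := BOp (@linearP _ _ _ _ (A \+ B)) (add_bop_subproof A B).

Lemma scale_bop_linear r A : linear (fun x => r%:C *: A x).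
Proof.
by move=> a x y; rewrite linearP scalerDr !scalerA mulrC.
Qed.

Lemma scale_bop_subproof r A :
  exists M : R, forall x, hnorm (r%:C *: A x) <= M * hnorm x.
Proof.
have [M _ AM] := bop_bounded_gt0 A.
by exists (`|r| * M) => x; rewrite hnormZr -mulrA ler_wpM2l.
Qed.

Definition scale_bop r A := BOp (scale_bop_linear r A) (scale_bop_subproof r A).

Lemma add_bopA : associative add_bop.
Proof. by move=> A B D; apply/bop_ext => x /=; rewrite addrA. Qed.
Lemma add_bopC : commutative add_bop.
Proof. by move=> A B; apply/bop_ext => x /=; rewrite addrC. Qed.
Lemma add_0bop : left_id zero_bop add_bop.
Proof. by move=> A; apply/bop_ext => x /=; rewrite add0r. Qed.
Lemma add_Nbop : left_inverse zero_bop (scale_bop (-1)) add_bop.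
Proof.
by move=> A; apply/bop_ext => x /=; rewrite rmorphN scaleN1r addNr.
Qed.

HB.instance Definition _ :=
  GRing.isZmodule.Build (bop H) add_bopA add_bopC add_0bop add_Nbop.

Lemma scale_bopA r s A :
  scale_bop r (scale_bop s A) = scale_bop (r * s) A.
Proof. by apply/bop_ext => x /=; rewrite scalerA rmorphM. Qed.
Lemma scale_1bop : left_id 1 scale_bop.
Proof. by move=> A; apply/bop_ext => x /=; rewrite scale1r. Qed.
Lemma scale_bopDr : right_distributive scale_bop +%R.
Proof. by move=> r A B; apply/bop_ext => x /=; rewrite scalerDr. Qed.
Lemma scale_bopDl A : {morph scale_bop^~ A : r s / r + s}.
Proof. by move=> r s; apply/bop_ext => x /=; rewrite rmorphD/= scalerDl. Qed.

HB.instance Definition _ := GRing.Zmodule_isLmodule.Build R (bop H)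
  scale_bopA scale_1bop scale_bopDr scale_bopDl.

Definition opnorm A : R := sup [set hnorm (A x) | x in [set x | hnorm x <= 1]].

Lemma opnorm_has_sup A : has_sup [set hnorm (A x) | x in [set x | hnorm x <= 1]].
Proof.
split; first by exists (hnorm (A 0)), 0; rewrite //= hnorm0.
have [M M0 AM] := bop_bounded_gt0 A; exists M => _ [x /= x1 <-].
by rewrite (le_trans (AM x))// -[leRHS]mulr1 ler_wpM2l// ltW.
Qed.

Lemma hnorm_le_opnorm A x : hnorm (A x) <= opnorm A * hnorm x.
Proof.
have [->|x0] := eqVneq x 0; first by rewrite linear0 hnorm0 mulr0.
have nx0 : 0 < hnorm x.
  by rewrite lt_neqAle hnorm_ge0 eq_sym andbT; apply: contra_neq x0 => /hnorm0_eq0.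
rewrite -ler_pdivrMr// mulrC.
have -> : (hnorm x)^-1 * hnorm (A x) = hnorm (A (((hnorm x)^-1)%:C *: x)).
  by rewrite linearZ/= hnormZr ger0_norm// invr_ge0 ltW.
apply: ub_le_sup; first by case: (opnorm_has_sup A).
exists (((hnorm x)^-1)%:C *: x) => //=.
have i0 : 0 <= (hnorm x)^-1 by rewrite invr_ge0 ltW.
by rewrite hnormZr (ger0_norm i0) mulVf ?lt0r_neq0.
Qed.

Lemma opnorm_le A (M : R) :
  (forall x, hnorm x <= 1 -> hnorm (A x) <= M) -> opnorm A <= M.
Proof.
move=> AM; apply: ge_sup; first by case: (opnorm_has_sup A).
by move=> _ [x /= x1 <-]; exact: AM.
Qed.

Lemma opnorm_ge0 A : 0 <= opnorm A.
Proof.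
rewrite (le_trans (hnorm_ge0 (A 0)))//; apply: ub_le_sup.
  by case: (opnorm_has_sup A).
by exists 0; rewrite //= hnorm0.
Qed.

Lemma opnormD A B : opnorm (A + B) <= opnorm A + opnorm B.
Proof.
apply: opnorm_le => x x1; rewrite (le_trans (hnormD _ _))// lerD//.
  by rewrite (le_trans (hnorm_le_opnorm _ _))// ler_piMr// opnorm_ge0.
by rewrite (le_trans (hnorm_le_opnorm _ _))// ler_piMr// opnorm_ge0.
Qed.

Lemma opnorm_scale_le r A : opnorm (r *: A) <= `|r| * opnorm A.
Proof.
apply: opnorm_le => x x1; rewrite [leLHS]hnormZr ler_wpM2l//.
by rewrite (le_trans (hnorm_le_opnorm _ _))// ler_piMr// opnorm_ge0.
Qed.

Lemma opnormZ r A : opnorm (r *: A) = `|r| * opnorm A.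
Proof.
apply/eqP; rewrite eq_le opnorm_scale_le/=.
have [->|r0] := eqVneq r 0; first by rewrite normr0 mul0r opnorm_ge0.
rewrite mulrC -ler_pdivlMr ?normr_gt0// mulrC -normfV.
by rewrite (le_trans _ (opnorm_scale_le _ _))// scalerA mulVf// scale1r.
Qed.

Lemma opnorm_eq0 A : opnorm A = 0 -> A = 0.
Proof.
move=> A0; apply/bop_ext => x; apply/hnorm0_eq0/eqP.
by rewrite eq_le hnorm_ge0 andbT -(mul0r (hnorm x)) -A0 hnorm_le_opnorm.
Qed.

HB.instance Definition _ := Lmodule_isNormed.Build R (bop H)
  opnormD opnormZ opnorm_eq0.

End bop.

Local Notation "A *o B" := (comp_bop A B) (at level 40, left associativity).

Definition is_adjoint {R : realType} {H : hilbertType R} (A B : bop H) :=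
  forall x y, inner (A x) y = inner x (B y).

Definition exp_bop {R : realType} {H : hilbertType R} (A : bop H) : bop H :=
  limn (series (fun n => n`!%:R^-1 *: iter n (comp_bop A) id_bop)).

Definition is_orthoproj {R : realType} {H : hilbertType R}
    (V : set H) (P : bop H) :=
  [/\ P *o P = P, is_adjoint P P & range P = V].

(** Unbounded operators: linear maps defined on a linear subspace.  The values
of [op_fun] outside of [dom] are irrelevant. *)

Record operator {R : realType} (H : hilbertType R) := Operator {
  dom : set H ;
  op_fun :> H -> H ;
  dom0 : dom 0 ;
  dom_linear : forall a x y, dom x -> dom y -> dom (a *: x + y) ;
  op_linear : forall a x y, dom x -> dom y ->
    op_fun (a *: x + y) = a *: op_fun x + op_fun y
}.

Definition operator_of_bop {R : realType} {H : hilbertType R} (A : bop H) :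
    operator H :=
  @Operator R H setT A I (fun _ _ _ _ _ => I)
    (fun a x y _ _ => bop_linear A a x y).

Coercion operator_of_bop : bop >-> operator.

Section graph.
Context {R : realType} {H : hilbertType R}.
Implicit Types T : operator H.

Definition graph T : set (hsum H H) :=
  [set ((h, T h) : hsum H H) | h in dom T].

Definition bounded_op T :=
  exists M : R, forall h, dom T h -> hnorm (T h) <= M * hnorm h.

(* When [T] is closed, its graph is a closed subspace of a Hilbert space and the
   projection onto it exists and is unique; [get] picks it. *)
Definition proj_graph T : bop (hsum H H) := get (is_orthoproj (graph T)).

End graph.

Section riemann_sphere.
Context {R : realType} {H : hilbertType R}.
Local Notation K := (hsum H H).

Lemma p0_linear : linear (fun z : K => (z.1, 0) : K).
Proof.
move=> a z w; apply/pair_equal_spec; split=> //.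
by rewrite /= scaler0 addr0.
Qed.

Lemma p0_bounded :
  exists M : R, forall z : K, hnorm ((z.1, 0) : K) <= M * hnorm z.
Proof.
exists 1%R => z; rewrite mul1r -lecR -!hnormE.
rewrite (le_trans (hsum_norm_le _))//= normr0 addr0.
exact: (hsum_norm_fst z).
Qed.

Definition p0 : bop K := BOp p0_linear p0_bounded.

Definition riemann_sphere : set (bop K) :=
  [set p | exists U Us, [/\ is_adjoint U Us, U *o Us = id_bop,
                            Us *o U = id_bop & p = U *o p0 *o Us]].

Definition tangent_space (p : bop K) : set (bop K) :=
  [set X | is_adjoint X X /\ X *o p + p *o X = X].

(* C^1 up to the endpoints: the derivative on the open interval extends to a
   continuous function on the closed one. *)
Definition C1_on (a b : R) (gamma : R -> bop K) :=
  exists2 g : R -> bop K, {within `[a, b], continuous g} &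
    forall t, t \in `]a, b[ -> is_derive t (1 : R) gamma (g t).

Definition piecewise_C1 (gamma : R -> bop K) :=
  {within `[0, 1], continuous gamma} /\
  exists2 s : seq R, itv_partition 0 1 s &
    forall i, (i < size s)%N -> C1_on (nth 0 (0 :: s) i) (nth 0 s i) gamma.

(* At the finitely many break points [derive1] is arbitrary, which does not
   affect the integral. *)
Definition curve_length (gamma : R -> bop K) : \bar R :=
  (\int[lebesgue_measure]_(t in `[0%R, 1%R]) `|derive1 gamma t|%:E)%E.

Definition sphere_curves (p q : bop K) : set (R -> bop K) :=
  [set gamma | [/\ piecewise_C1 gamma,
     forall t, t \in `[0, 1] -> riemann_sphere (gamma t),
     gamma 0 = p & gamma 1 = q]].

(* [+oo] when [p] and [q] are not joined by a curve. *)
Definition finsler_dist (p q : bop K) : \bar R :=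
  ereal_inf [set curve_length gamma | gamma in sphere_curves p q].

Definition is_geodesic (gamma : R -> bop K) :=
  exists p X, [/\ riemann_sphere p, tangent_space p X &
    forall t, t \in `[0, 1] ->
      let Xt := X *o p - p *o X in
      gamma t = exp_bop (t *: Xt) *o p *o exp_bop (- t *: Xt)].

Definition finsler_lim_left (pt : R -> bop K) (alpha : R) (q : bop K) :=
  riemann_sphere q /\ finsler_dist (pt t) q @[t --> alpha^'-] --> 0%E.

Definition bounded_deformation (alpha : R) (T : operator H)
    (Tt : R -> bop H) :=
  [/\ 0 < alpha, {within `[0, alpha[, continuous Tt} &
      finsler_lim_left (fun t => proj_graph (Tt t)) alpha (proj_graph T)].

(* The curve [t |-> P_Gr(T_t)] on [0, alpha[, extended at [alpha] by its limit. *)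
Definition deformation_curve (alpha : R) (Tt : R -> bop H)
    (pt : R -> bop K) :=
  (forall t, t \in `[0, alpha[ -> pt t = proj_graph (Tt t)) /\
  finsler_lim_left (fun t => proj_graph (Tt t)) alpha (pt alpha).

End riemann_sphere.

(* There is a unique family indexed by [D] satisfying [P]; families are
   represented by functions on the whole line, compared on [D] only. *)
Definition exists_unique_on {R V : Type} (D : set R) (P : (R -> V) -> Prop) :=
  exists2 f, P f & forall g, P g -> forall t, D t -> g t = f t.

(* Main.v *)
(** Let [P] be the projection onto the graph of [T], and let [eps0], [eps1] be
the symmetries [2 p0 - 1] and [2 P - 1].  A geodesic issuing from [p0] is
[exp (t Y) p0 exp (- t Y)] with [Y] skew-adjoint and anticommuting with [eps0],
and it ends at [P] iff [exp (2 Y) = eps1 eps0].  Density of the domain makes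
[eps0 + eps1] injective, i.e. [-1] is not an eigenvalue of [eps1 eps0].

Existence: the sign of [eps0 + eps1] is a midpoint symmetry; bisecting again and
again gives unitary roots [u_n] with [u_(n+1)^2 = u_n] and nonnegative real
part, and [Y] is the limit of [2^n (u_n - 1)].  With [C(t)] the real part of
[exp (t Y)], the identity [2 C(s) C(t) = C(s + t) + C(s - t)] propagates
[C(2^-n) >= 0] to a strictly positive lower bound of [C(t)] for [0 <= t < 1], so
[exp (t Y) p0 exp (- t Y)] is the projection onto the graph of the bounded
operator [T_t] given by the off-diagonal block of [sin (t Y) / cos (t Y)].

Uniqueness: if the geodesic stays among graphs of bounded operators for
[0 <= t < 1], then [C(t)] is bounded below there, hence stays nonnegative by connectedness.
A unitary root with nonnegative real part is unique, so all [exp (2^-n Y)], and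
therefore [Y], are determined. *)

From HB Require Import structures.
From mathcomp Require Import all_boot all_order all_algebra sesquilinear.
From mathcomp Require Import all_classical all_reals all_analysis.
From mathcomp.real_closed Require Import complex.
From mathcomp Require Import ring lra.
Require Import Defs.
Import Order.TTheory GRing.Theory Num.Theory.
Import numFieldNormedType.Exports.
Set Implicit Arguments.
Unset Strict Implicit.
Unset Printing Implicit Defensive.
Local Open Scope classical_set_scope.
Local Open Scope ring_scope.

(** * Real part of the inner product and quadratic forms *)

Section real_inner_product.
Context {R : realType} {H : hilbertType R}.
Implicit Types (x y z : H) (r : R).

(** No functional calculus is used. Its place is taken by a square-root iteration whose limit
    commutes with everything that commutes with the given operator, by Neumann and exponential
    series, and by the inequality [|A x|^2 <= q <A x, x>] for [0 <= A <= q]. The obstacle is that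
    [eps0 + eps1] is only injective: its absolute value is [2 C(1)], which is not bounded below when
    [T] is unbounded. Signs, midpoints and roots are therefore identified by cancelling injective
    factors, never by inverting them, and positivity becomes invertibility only for [t < 1], with
    constants that may degrade as [t] tends to 1. Among the many logarithms of [eps1 eps0], the
    condition [C(2^-n) >= 0] for all [n] singles out one; existence and uniqueness meet there. It
    also drives the convergence: [|u_n - 1|^2] shrinks at least by the factor 3 at each root, which
    beats the factor 2 in [2^n (u_n - 1)], whose increments are quadratic in [u_(n+1) - 1]. *)

Definition rdot x y : R := complex.Re (inner x y).

Lemma innerC x y : inner x y = (inner y x)^*.
Proof. by rewrite (hermC inner) expr0 mul1r. Qed.

Lemma rdotC x y : rdot x y = rdot y x.
Proof. by rewrite /rdot innerC; case: (inner y x). Qed.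

Lemma rdotDl x y z : rdot (x + y) z = rdot x z + rdot y z.
Proof. by rewrite /rdot linearDl /=; case: (inner x z); case: (inner y z). Qed.

Lemma rdotDr x y z : rdot z (x + y) = rdot z x + rdot z y.
Proof. by rewrite rdotC rdotDl ![rdot _ z]rdotC. Qed.

Lemma rdotZl r x y : rdot (r%:C%C *: x) y = r * rdot x y.
Proof.
rewrite /rdot linearZl_LR /=; case: (inner x y) => a b /=.
by rewrite mul0r subr0.
Qed.

Lemma rdotZr r x y : rdot x (r%:C%C *: y) = r * rdot x y.
Proof. by rewrite rdotC rdotZl rdotC. Qed.

Lemma rdotNl x y : rdot (- x) y = - rdot x y.
Proof. by rewrite /rdot linearNl /=; case: (inner x y). Qed.

Lemma rdotNr x y : rdot x (- y) = - rdot x y.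
Proof. by rewrite rdotC rdotNl rdotC. Qed.

Lemma rdotBl x y z : rdot (x - y) z = rdot x z - rdot y z.
Proof. by rewrite rdotDl rdotNl. Qed.

Lemma rdotBr x y z : rdot z (x - y) = rdot z x - rdot z y.
Proof. by rewrite rdotDr rdotNr. Qed.

Lemma rdot0l x : rdot 0 x = 0.
Proof. by rewrite -(subrr 0) rdotBl subrr. Qed.

Lemma rdot0r x : rdot x 0 = 0.
Proof. by rewrite rdotC rdot0l. Qed.

Lemma rdotxx x : rdot x x = hnorm x ^+ 2.
Proof. by rewrite /rdot -sqr_norm_inner hnormE -rmorphXn. Qed.

Lemma hnormN x : hnorm (- x) = hnorm x.
Proof. by rewrite /hnorm normrN. Qed.

Lemma hnormB_sqr x y :
  hnorm (x - y) ^+ 2 = hnorm x ^+ 2 - rdot x y *+ 2 + hnorm y ^+ 2.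
Proof. by rewrite -!rdotxx rdotBl !rdotBr (rdotC y x); ring. Qed.

Lemma hnormD_sqr x y :
  hnorm (x + y) ^+ 2 = hnorm x ^+ 2 + rdot x y *+ 2 + hnorm y ^+ 2.
Proof. by rewrite -!rdotxx rdotDl !rdotDr (rdotC y x); ring. Qed.

Lemma rdotxx_ge0 x : 0 <= rdot x x.
Proof. by rewrite rdotxx sqr_ge0. Qed.

Lemma rdotxx_eq0 x : rdot x x = 0 -> x = 0.
Proof. by rewrite rdotxx => /eqP; rewrite sqrf_eq0 => /eqP/hnorm0_eq0. Qed.

(* Multiplication by [i] is orthogonal, and pairing with ['i *: y] recovers the
   imaginary part of the inner product. *)
Lemma inner_rdot x y : inner x y = (rdot x y +i* rdot x ('i%C *: y))%C.
Proof.
rewrite /rdot linearZr_LR /=; case: (inner x y) => a b /=.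
by congr Complex; rewrite mul0r sub0r mulN1r opprK.
Qed.

(** Complex linearity of [B] suffices: pairing with ['i *: y] turns imaginary parts into real ones.
    Most adjoint computations can thus be done with [rdot]. *)
Lemma is_adjointP (A B : bop H) :
  is_adjoint A B <-> forall x y, rdot (A x) y = rdot x (B y).
Proof.
split=> [AB x y|AB x y]; first by rewrite /rdot AB.
by rewrite !inner_rdot !AB linearZ.
Qed.

(** The degenerate case [c = 0] matters, since [form_CS] applies this to forms that are only
    semidefinite. *)
Lemma quadratic_discr (a b c : R) :
  (forall t, 0 <= a + b * t *+ 2 + c * t ^+ 2) -> b ^+ 2 <= a * c.
Proof.
move=> h.
have a0 : 0 <= a by have := h 0; rewrite mulr0 mul0rn expr0n/= mulr0 !addr0.
have c0 : 0 <= c.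
  rewrite leNgt; apply/negP => c0.
  have k0 : 0 < (a + b ^+ 2 + 1) / - c.
    by rewrite divr_gt0 ?oppr_gt0// ltr_wpDl ?addr_ge0 ?sqr_ge0.
  (* Adding the values at [t] and [- t] removes [b]; this [t >= 1] makes [c * t] so negative that
     [a + c * t ^+ 2 < 0]. *)
  set t := 1 + (a + b ^+ 2 + 1) / - c; have t1 : 1 <= t by rewrite lerDl ltW.
  have := h t; have := h (- t) => h1 h2.
  have : 0 <= a + c * t ^+ 2 by nra.
  have ct : c * t = c - (a + b ^+ 2 + 1).
    by rewrite /t mulrDr mulr1; field; rewrite lt_eqF.
  rewrite expr2 mulrA ct; have := sqr_ge0 b; nra.
have [c00|cN0] := eqVneq c 0.
  rewrite c00 mulr0; move: h; rewrite c00 => h.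
  have [->|bN0] := eqVneq b 0; first by rewrite expr0n.
  have := h (- (a + 1) / b); rewrite mulrCA mulfV// mulr1 mul0r addr0; lra.
have cp : 0 < c by rewrite lt_neqAle eq_sym cN0.
have := h (- b / c).
have -> : a + b * (- b / c) *+ 2 + c * (- b / c) ^+ 2 = (a * c - b ^+ 2) / c.
  by field.
by rewrite pmulr_lge0 ?invr_gt0// subr_ge0.
Qed.

Definition pos (A : bop H) := forall x, 0 <= rdot (A x) x.

Lemma form_CS (A : bop H) x y : is_adjoint A A -> pos A ->
  rdot (A x) y ^+ 2 <= rdot (A x) x * rdot (A y) y.
Proof.
move=> /is_adjointP sA pA; apply: quadratic_discr => t.
have := pA (x + t%:C%C *: y).
rewrite linearD linearZ/= rdotDl !rdotDr !rdotZl !rdotZr.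
rewrite (_ : rdot (A y) x = rdot (A x) y) 1?rdotC ?sA//.
by congr (_ <= _); ring.
Qed.

Lemma is_adjoint_id : is_adjoint (@id_bop R H) id_bop.
Proof. by []. Qed.

Lemma rdot_CS x y : `|rdot x y| <= hnorm x * hnorm y.
Proof.
have := form_CS x y is_adjoint_id (@rdotxx_ge0).
rewrite /= !rdotxx -exprMn => h.
rewrite -(@ler_pXn2r _ 2) ?nnegrE ?mulr_ge0 ?hnorm_ge0//.
by rewrite real_normK ?num_real.
Qed.

Lemma rdot_le x y : rdot x y <= hnorm x * hnorm y.
Proof. exact: le_trans (ler_norm _) (rdot_CS _ _). Qed.

(** Cauchy-Schwarz for the form of [A] at [x] and [A x] bounds [|A x|^4] by [<A x, x> * q |A x|^2].
    This replaces the spectral inequality [A^2 <= q A]. *)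
Lemma form_bound_norm (A : bop H) (q : R) : 0 <= q -> is_adjoint A A -> pos A ->
  (forall x, rdot (A x) x <= q * hnorm x ^+ 2) ->
  forall x, hnorm (A x) ^+ 2 <= q * rdot (A x) x.
Proof.
move=> q0 sA pA Aq x; have := form_CS x (A x) sA pA; rewrite rdotxx => h.
have [->|AN0] := eqVneq (hnorm (A x)) 0.
  by rewrite expr0n mulr_ge0.
have A0 : 0 < hnorm (A x) ^+ 2.
  by rewrite exprn_gt0// lt_neqAle eq_sym AN0 hnorm_ge0.
rewrite -(ler_pM2r A0) -expr2 (le_trans h)// [leRHS]mulrAC mulrC.
by rewrite ler_wpM2r.
Qed.

End real_inner_product.

(** * The Banach algebra of bounded operators *)

Section bop_ring.
Context {R : realType} {H : hilbertType R}.
Implicit Types A B C : bop H.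

Lemma comp_bopA : associative (@comp_bop R H).
Proof. by move=> A B C; exact/bop_ext. Qed.
Lemma comp_1bop : left_id id_bop (@comp_bop R H).
Proof. by move=> A; exact/bop_ext. Qed.
Lemma comp_bop1 : right_id id_bop (@comp_bop R H).
Proof. by move=> A; exact/bop_ext. Qed.
Lemma comp_bopDl : left_distributive (@comp_bop R H) +%R.
Proof. by move=> A B C; exact/bop_ext. Qed.
Lemma comp_bopDr : right_distributive (@comp_bop R H) +%R.
Proof. by move=> A B C; apply/bop_ext => x /=; rewrite linearD. Qed.

HB.instance Definition _ := GRing.Zmodule_isPzRing.Build (bop H)
  comp_bopA comp_1bop comp_bop1 comp_bopDl comp_bopDr.

Lemma comp_bopE A B : comp_bop A B = A * B. Proof. by []. Qed.
Lemma bopM A B x : (A * B) x = A (B x). Proof. by []. Qed.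
Lemma bop1 x : (1 : bop H) x = x. Proof. by []. Qed.
Lemma bop0 x : (0 : bop H) x = 0. Proof. by []. Qed.
Lemma bopD A B x : (A + B) x = A x + B x. Proof. by []. Qed.
Lemma bopZ (r : R) A x : (r *: A) x = (r%:C)%C *: A x. Proof. by []. Qed.
Lemma bopN A x : (- A) x = - A x.
Proof. by rewrite -scaleN1r bopZ rmorphN scaleN1r. Qed.
Lemma bopB A B x : (A - B) x = A x - B x. Proof. by rewrite bopD bopN. Qed.

Lemma bop_scalerAl (r : R) A B : r *: (A * B) = r *: A * B.
Proof. exact/bop_ext. Qed.
Lemma bop_scalerAr (r : R) A B : r *: (A * B) = A * (r *: B).
Proof. by apply/bop_ext => x; rewrite !bopM !bopZ linearZ. Qed.

Lemma hnorm_bop A x : hnorm (A x) <= `|A| * hnorm x.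
Proof. exact: hnorm_le_opnorm. Qed.

Lemma bop_norm_le A (M : R) : 0 <= M -> (forall x, hnorm (A x) <= M * hnorm x) ->
  `|A| <= M.
Proof.
move=> M0 AM; apply: opnorm_le => x x1.
by rewrite (le_trans (AM x))// ler_piMr.
Qed.

Lemma bop_normM A B : `|A * B| <= `|A| * `|B|.
Proof.
apply: bop_norm_le => [|x]; first by rewrite mulr_ge0.
by rewrite bopM (le_trans (hnorm_bop _ _))// -mulrA ler_wpM2l// hnorm_bop.
Qed.

(** Only an inequality, since [1 = 0] when [H] is trivial. *)
Lemma bop_norm1 : `|1 : bop H| <= 1.
Proof. by apply: bop_norm_le => // x; rewrite mul1r. Qed.

Lemma bop_normX A n : `|A ^+ n| <= `|A| ^+ n.
Proof.
elim: n => [|n IH]; first by rewrite !expr0 bop_norm1.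
by rewrite !exprS (le_trans (bop_normM _ _))// ler_wpM2l.
Qed.

(** Pointwise limits exist by completeness of [H]; the Cauchy estimate is uniform in [x], so it
    survives the pointwise limit and gives convergence in operator norm. *)
Lemma bop_complete (F : set_system (bop H)) :
  ProperFilter F -> cauchy F -> cvg F.
Proof.
move=> FF Fc.
have Fn (e : R) : 0 < e ->
    exists2 S : set (bop H), F S & forall A B, S A -> S B -> `|A - B| <= e.
  move=> e0; have [[S S'] /= [FS FS'] SS] := (iffRL (cauchy_ballP F)) Fc e e0.
  exists (S `&` S'); first exact: filterI.
  move=> A B [SA _] [_ SB]; have := SS (A, B) (conj SA SB).
  by rewrite -ball_normE/= => /ltW.
have cx x : cvg ((fun A : bop H => A x) @ F).
  apply: cauchy_cvg; apply/cauchy_ballP => e e0.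
  (* The norm of [H] takes values in [R[i]], where a positive element is automatically real. *)
  have er : e = ((complex.Re e)%:C)%C by rewrite RRe_real// gtr0_real.
  have re0 : 0 < complex.Re e by rewrite -ltcR -er.
  have d0 : 0 < complex.Re e / (hnorm x + 1).
    by rewrite divr_gt0// ltr_wpDl ?hnorm_ge0.
  have [S FS SS] := Fn _ d0.
  exists ((fun A : bop H => A x) @` S, (fun A : bop H => A x) @` S) => /=.
    by split; apply: (@filterS _ F _ S) => // A SA; exists A.
  move=> [_ _] /= [[A SA <-] [B SB <-]].
  rewrite -ball_normE/= hnormE er ltcR -bopB.
  rewrite (le_lt_trans (hnorm_bop _ _))//.
  rewrite (@le_lt_trans _ _ (complex.Re e / (hnorm x + 1) * hnorm x))//.
    by rewrite ler_wpM2r ?hnorm_ge0// SS.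
  by rewrite mulrAC ltr_pdivrMr ?ltr_wpDl ?hnorm_ge0// ltr_pM2l// ltrDl.
pose f x := lim ((fun A : bop H => A x) @ F).
have fF x : (fun A : bop H => A x) @ F --> f x by exact: cx.
have f_lin : linear f.
  move=> a x y; apply: cvg_lim; first exact: norm_hausdorff.
  rewrite [X in X @ _](_ : _ = fun A : bop H => a *: A x + A y).
    by apply: cvgD (fF y); apply: cvgZr; exact: fF.
  by apply/funext => A; rewrite linearP.
have near_le (e : R) : 0 < e ->
    exists2 S : set (bop H), F S &
      forall A x, S A -> hnorm (A x - f x) <= e * hnorm x.
  move=> e0; have [S FS SS] := Fn e e0; exists S => // A x SA.
  apply/ler_addgt0Pr => d d0.
  have dC : (0 : R[i]) < d%:C%C by rewrite ltcR.
  have FB : F [set C : bop H | `|f x - C x| < d%:C%C].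
    exact: (@cvgr_dist_lt _ _ _ F _ (fun C : bop H => C x) _ (fF x) _ dC).
  have [B [SB]] := @filter_ex _ F _ _ (filterI FS FB).
  rewrite /= hnormE ltcR => fB.
  have -> : A x - f x = (A - B) x - (f x - B x) by rewrite bopB opprB addrA subrK.
  rewrite (le_trans (hnormD _ _))// hnormN lerD ?(ltW fB)//.
  by rewrite (le_trans (hnorm_bop _ _))// ler_wpM2r ?hnorm_ge0// SS.
have f_bd : exists M : R, forall x, hnorm (f x) <= M * hnorm x.
  have [S FS SS] := near_le 1 ltr01; have [A SA] := filter_ex FS.
  exists (`|A| + 1) => x.
  have -> : f x = A x - (A x - f x) by rewrite opprB addrC subrK.
  rewrite (le_trans (hnormD _ _))// hnormN mulrDl lerD ?hnorm_bop//.
  exact: SS.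
apply/cvg_ex; exists (BOp f_lin f_bd); apply/cvgrPdist_le => e e0.
have [S FS SS] := near_le e e0; apply: filterS FS => A SA.
rewrite distrC; apply: bop_norm_le => [|x]; first exact: ltW.
by rewrite bopB; exact: SS.
Qed.

HB.instance Definition _ := Uniform_isComplete.Build (bop H) bop_complete.

Lemma bop_cvgM {T : Type} (F : set_system T) {FF : Filter F} (f g : T -> bop H) A B :
  f @ F --> A -> g @ F --> B -> (fun t => f t * g t) @ F --> A * B.
Proof.
move=> fA gB; apply/subr_cvg0/norm_cvg0P.
have dF : (fun t => `|f t - A|) @ F --> (0 : R) by apply/norm_cvg0P/subr_cvg0.
have dG : (fun t => `|g t - B|) @ F --> (0 : R) by apply/norm_cvg0P/subr_cvg0.
have nG : (fun t => `|g t|) @ F --> `|B| by apply: cvg_norm.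
apply: (@squeeze_cvgr _ _ _ _ (fun=> 0)
    (fun t => `|f t - A| * `|g t| + `|A| * `|g t - B|)).
- near=> t; rewrite normr_ge0/=.
  have -> : f t * g t - A * B = (f t - A) * g t + A * (g t - B).
    by rewrite mulrBl mulrBr addrA subrK.
  by rewrite (le_trans (ler_normD _ _))// lerD// bop_normM.
- exact: cvg_cst.
- rewrite -[X in _ --> X](_ : 0 * `|B| + `|A| * 0 = 0); last by rewrite mul0r mulr0 addr0.
  by apply: cvgD; apply: cvgM => //; exact: cvg_cst.
Unshelve. all: by end_near. Qed.

Lemma bop_cvg_app {T : Type} (F : set_system T) {FF : Filter F} (f : T -> bop H) A :
  f @ F --> A -> forall x, (fun t => hnorm (f t x - A x)) @ F --> (0 : R).
Proof.
move=> fA x; have dF : (fun t => `|f t - A|) @ F --> (0 : R).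
  by apply/norm_cvg0P/subr_cvg0.
apply: (@squeeze_cvgr _ _ _ _ (fun=> 0) (fun t => `|f t - A| * hnorm x)).
- by near=> t; rewrite hnorm_ge0/= -bopB hnorm_bop.
- exact: cvg_cst.
- by rewrite -(mul0r (hnorm x)); apply: cvgM => //; exact: cvg_cst.
Unshelve. all: by end_near. Qed.

Lemma bop_cvg_rdot {T : Type} (F : set_system T) {FF : Filter F} (f : T -> bop H) A :
  f @ F --> A -> forall x y, (fun t => rdot (f t x) y) @ F --> rdot (A x) y.
Proof.
move=> fA' x y; have fA : (fun t => hnorm (f t x - A x)) @ F --> (0 : R).
  exact: bop_cvg_app.
apply/subr_cvg0/norm_cvg0P.
apply: (@squeeze_cvgr _ _ _ _ (fun=> 0) (fun t => hnorm (f t x - A x) * hnorm y)).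
- by near=> t; rewrite normr_ge0/= -rdotBl rdot_CS.
- exact: cvg_cst.
- by rewrite -(mul0r (hnorm y)); apply: cvgM; [exact: fA|exact: cvg_cst].
Unshelve. all: by end_near. Qed.

Lemma is_adjoint_lim {T : Type} (F : set_system T) {FF : ProperFilter F}
    (f g : T -> bop H) A B : (forall t, is_adjoint (f t) (g t)) ->
  f @ F --> A -> g @ F --> B -> is_adjoint A B.
Proof.
move=> fg fA gB; apply/is_adjointP => x y.
have h1 : (fun t => rdot (f t x) y) @ F --> rdot (A x) y.
  exact: bop_cvg_rdot.
have h2 : (fun t => rdot (g t y) x) @ F --> rdot (B y) x.
  exact: bop_cvg_rdot.
rewrite [RHS]rdotC; apply: (cvg_unique _ h1) => //.
rewrite [X in X @ _](_ : _ = fun t => rdot (g t y) x)//.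
by apply/funext => t; have /is_adjointP -> := fg t; rewrite rdotC.
Qed.

Lemma pos_lim {T : Type} (F : set_system T) {FF : ProperFilter F}
    (f : T -> bop H) A : (\forall t \near F, pos (f t)) -> f @ F --> A -> pos A.
Proof.
move=> pf fA x; have h : (fun t => rdot (f t x) x) @ F --> rdot (A x) x.
  exact: bop_cvg_rdot.
rewrite -(cvg_lim _ h)//; apply: limr_ge; first exact: cvgP h.
by apply: filterS pf => t /(_ x).
Qed.

Lemma adjD A A' B B' : is_adjoint A A' -> is_adjoint B B' ->
  is_adjoint (A + B) (A' + B').
Proof.
move=> /is_adjointP a /is_adjointP b; apply/is_adjointP => x y.
by rewrite !bopD rdotDl rdotDr a b.
Qed.

Lemma adjZ (r : R) A A' : is_adjoint A A' -> is_adjoint (r *: A) (r *: A').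
Proof.
move=> /is_adjointP a; apply/is_adjointP => x y.
by rewrite !bopZ rdotZl rdotZr a.
Qed.

Lemma adjN A A' : is_adjoint A A' -> is_adjoint (- A) (- A').
Proof. by move=> /(adjZ (-1)); rewrite !scaleN1r. Qed.

Lemma adjB A A' B B' : is_adjoint A A' -> is_adjoint B B' ->
  is_adjoint (A - B) (A' - B').
Proof. by move=> a /adjN; exact: adjD. Qed.

Lemma adjM A A' B B' : is_adjoint A A' -> is_adjoint B B' ->
  is_adjoint (A * B) (B' * A').
Proof. by move=> a b x y; rewrite !bopM a b. Qed.

Lemma adj1 : is_adjoint (1 : bop H) 1. Proof. by []. Qed.

Lemma adjX A A' n : is_adjoint A A' -> is_adjoint (A ^+ n) (A' ^+ n).
Proof.
move=> a; elim: n => [|n IH]; first exact: adj1.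
by rewrite exprS exprSr; exact: adjM.
Qed.

Lemma adjC A B : is_adjoint A B -> is_adjoint B A.
Proof.
by move=> /is_adjointP a; apply/is_adjointP => x y; rewrite rdotC -a rdotC.
Qed.

Lemma adj_uniq A B C : is_adjoint A B -> is_adjoint A C -> B = C.
Proof.
move=> /is_adjointP ab /is_adjointP ac; apply/bop_ext => y.
apply/eqP; rewrite -subr_eq0; apply/eqP/rdotxx_eq0.
by rewrite [LHS]rdotBr -ab -ac subrr.
Qed.

Lemma adj_norm A B : is_adjoint A B -> forall x, hnorm (A x) ^+ 2 = rdot (B (A x)) x.
Proof.
by move=> /adjC/is_adjointP a x; rewrite -rdotxx a.
Qed.

End bop_ring.

(** * Orthogonal projection onto a closed subspace *)

Section projection_theorem.
Context {R : realType} {H : hilbertType R}.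
Implicit Types (x y v w : H) (V : set H).

Lemma innerPl (a : R[i]) x y z :
  inner (a *: x + y) z = a * inner x z + inner y z.
Proof. by rewrite linearDl /= linearZl_LR. Qed.

Lemma hilbert_cauchy (u : nat -> H) (b : nat -> R) : b @ \oo --> 0 ->
  (forall n m, hnorm (u n - u m) <= b n + b m) -> cvg (u @ \oo).
Proof.
move=> b0 ub; apply: cauchy_cvg; apply/cauchy_ballP => e e0.
have er : e = ((complex.Re e)%:C)%C by rewrite RRe_real// gtr0_real.
have re0 : 0 < complex.Re e by rewrite -ltcR -er.
have [N _ bN] : \forall n \near \oo, `|b n| < complex.Re e / 2.
  by apply: cvgr0_norm_lt b0 _ _; rewrite divr_gt0.
exists (u @` [set n | (N <= n)%N], u @` [set n | (N <= n)%N]) => /=.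
  by split; exists N => // n Nn; exists n.
move=> [_ _] /= [[n Nn <-] [m Nm <-]]; rewrite -ball_normE/= hnormE er ltcR.
rewrite (le_lt_trans (ub _ _))// [ltRHS]splitr.
by rewrite ltrD// (le_lt_trans (ler_norm _))//; exact: bN.
Qed.

Lemma hilbert_cvg_dist (u : nat -> H) x (e : R) : u @ \oo --> x -> 0 < e ->
  \forall n \near \oo, hnorm (x - u n) < e.
Proof.
move=> ux e0; have eC : (0 : R[i]) < e%:C%C by rewrite ltcR.
have uN : \forall n \near \oo, `|x - u n| < e%:C%C.
  exact: (@cvgr_dist_lt _ _ _ \oo _ u _ ux _ eC).
by apply: filterS uN => n; rewrite hnormE ltcR.
Qed.

Section subspace.
Context (V : set H) (V0 : V 0).
Context (V_linear : forall a x y, V x -> V y -> V (a *: x + y)).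

Lemma subspaceZ a x : V x -> V (a *: x).
Proof. by move=> Vx; rewrite -[X in V X]addr0; exact: V_linear. Qed.

Lemma subspaceB x y : V x -> V y -> V (x - y).
Proof. by move=> Vx Vy; rewrite -scaleN1r addrC; exact: V_linear. Qed.

(** A minimizing sequence [v] is almost orthogonal: [|<x - v n, w>| <= harmonic n * |w|] on [V].
    This estimate gives both the Cauchy property, by taking [w = v n - v m], and the orthogonality
    of the limit. *)
Lemma projection_point x : closed V ->
  exists l, V l /\ forall w, V w -> rdot (x - l) w = 0.
Proof.
move=> clV; pose D := [set hnorm (x - v) ^+ 2 | v in V]; pose d := inf D.
have hasD : has_inf D.
  split; first by exists (hnorm (x - 0) ^+ 2), 0.
  by exists 0 => _ [v _ <-]; exact: sqr_ge0.
have dD v : V v -> d <= hnorm (x - v) ^+ 2.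
  by move=> Vv; apply: ge_inf; [case: hasD|exists v].
have /choice[v vP] n : exists v, V v /\ hnorm (x - v) ^+ 2 < d + harmonic n ^+ 2.
  have e0 : 0 < harmonic n ^+ 2 :> R by rewrite exprn_gt0// harmonic_gt0.
  by have [_ [v Vv <-] vd] := inf_adherent e0 hasD; exists v.
have ortho n w : V w -> `|rdot (x - v n) w| <= harmonic n * hnorm w.
  move=> Vw; have h0 : 0 <= harmonic n :> R by rewrite harmonic_ge0.
  rewrite -(@ler_pXn2r _ 2) ?nnegrE ?mulr_ge0 ?hnorm_ge0//.
  rewrite real_normK ?num_real// exprMn.
  (* Moving [v n] by a multiple of [w] stays in [V], so the squared distance cannot drop below [d],
     while at [v n] it exceeds [d] by less than [harmonic n ^+ 2]. The discriminant of this
     quadratic in [t] is the claim. *)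
  apply: quadratic_discr => t; have [Vv vd] := vP n.
  have := dD (v n - t%:C%C *: w) (subspaceB Vv (subspaceZ _ Vw)).
  rewrite opprB addrCA hnormD_sqr hnormZr exprMn real_normK ?num_real//.
  rewrite rdotZl [rdot w _]rdotC; move: vd; lra.
have vcauchy n m : hnorm (v n - v m) <= harmonic n + harmonic m.
  have Vw : V (v n - v m) by apply: subspaceB; case: (vP n); case: (vP m).
  have [->|wN0] := eqVneq (hnorm (v n - v m)) 0.
    by rewrite addr_ge0 ?harmonic_ge0.
  have w0 : 0 < hnorm (v n - v m) by rewrite lt_neqAle eq_sym wN0 hnorm_ge0.
  rewrite -(ler_pM2r w0) -expr2 -rdotxx {1}(_ : v n - v m = (x - v m) - (x - v n)).
    rewrite rdotBl mulrDl addrC lerD//.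
      by rewrite (le_trans _ (ortho n _ Vw))// -normrN ler_norm.
    exact: le_trans (ler_norm _) (ortho m _ Vw).
  by rewrite opprB [RHS]addrC addrA subrK.
have /cvg_ex[l vl] := hilbert_cauchy (@cvg_harmonic R) vcauchy.
exists l; split.
  apply: (@closed_cvg _ _ \oo _ v V clV _ l vl); near=> n; by case: (vP n).
move=> w Vw; apply/eqP; rewrite -normr_le0.
apply/ler_addgt0Pr => e e0; rewrite add0r.
pose c := hnorm w + 1; have c0 : 0 < c by rewrite ltr_wpDl ?hnorm_ge0.
have ec : 0 < e / 2 / c by rewrite !divr_gt0.
have near1 := hilbert_cvg_dist vl ec.
have near2 : \forall n \near \oo, `|@harmonic R n| < e / 2 / c.
  exact: cvgr0_norm_lt (@cvg_harmonic R) _ ec.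
have [n [/= vln hn]] := @filter_ex _ \oo _ _ (filterI near1 near2).
have -> : x - l = (x - v n) - (l - v n) by rewrite opprB addrA subrK.
rewrite rdotBl (le_trans (ler_normB _ _))// [leRHS]splitr.
have cw : e / 2 / c * hnorm w <= e / 2.
  by rewrite mulrAC ler_pdivrMr// ler_pM2l ?divr_gt0// lerDl.
rewrite lerD// (le_trans _ cw)//.
  rewrite (le_trans (ortho n _ Vw))// ler_wpM2r ?hnorm_ge0//.
  exact: le_trans (ler_norm _) (ltW hn).
by rewrite (le_trans (rdot_CS _ _))// ler_wpM2r ?hnorm_ge0// ltW.
Unshelve. all: by end_near. Qed.

Theorem orthoproj_exists : closed V -> exists P, is_orthoproj V P.
Proof.
move=> clV; have /choice[p pP] := fun x => projection_point x clV.
have Vp x : V (p x) by case: (pP x).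
have orth x w : V w -> rdot x w = rdot (p x) w.
  by case: (pP x) => _ h /h; rewrite rdotBl => /eqP; rewrite subr_eq0 => /eqP.
have p_uniq x y : V y -> (forall w, V w -> rdot x w = rdot y w) -> p x = y.
  move=> Vy xy; apply/eqP; rewrite -subr_eq0; apply/eqP/rdotxx_eq0.
  have Vd : V (p x - y) by exact: subspaceB.
  by rewrite rdotBl -orth// xy// subrr.
have p_lin : linear p.
  move=> a x y; apply: p_uniq => [|w Vw]; first exact: V_linear.
  (* [V] is stable under multiplication by [i], so real orthogonality upgrades to complex
     orthogonality, as needed for complex linearity. *)
  have Hinner z u : V u -> inner z u = inner (p z) u.
    move=> Vu; have Viu := subspaceZ 'i%C Vu.
    by rewrite !inner_rdot (orth z u Vu) (orth z _ Viu).
  by rewrite /rdot !innerPl (Hinner x w)// (Hinner y w).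
have p_norm x : hnorm (p x) <= 1 * hnorm x.
  rewrite mul1r; have [->|xN0] := eqVneq (hnorm (p x)) 0; first exact: hnorm_ge0.
  have x0 : 0 < hnorm (p x) by rewrite lt_neqAle eq_sym xN0 hnorm_ge0.
  by rewrite -(ler_pM2r x0) -expr2 -rdotxx -orth// rdot_le.
exists (BOp p_lin (ex_intro _ 1 p_norm)); split.
- by apply/bop_ext => x /=; apply: p_uniq.
- apply/is_adjointP => x y /=.
  by rewrite rdotC (orth y (p x))// rdotC -(orth x (p y)).
- apply/seteqP; split=> [_ [x _ <-]|x Vx]//=.
  by exists x => //; exact: p_uniq.
Qed.

End subspace.

Lemma orthoproj_fix V P x : is_orthoproj V P -> V x -> P x = x.
Proof. by case=> PP _ <- [y _ <-]; rewrite -[in RHS]PP. Qed.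

Lemma orthoproj_uniq V P Q : is_orthoproj V P -> is_orthoproj V Q -> P = Q.
Proof.
move=> Pp Qp.
have PQ : P * Q = Q.
  apply/bop_ext => x; apply: (orthoproj_fix Pp).
  by case: Qp => _ _ <-; exists x.
have QP : Q * P = P.
  apply/bop_ext => x; apply: (orthoproj_fix Qp).
  by case: Pp => _ _ <-; exists x.
case: Pp => _ sP _; case: Qp => _ sQ _.
have := adjM sP sQ; rewrite PQ => /(adj_uniq sQ) ->.
by rewrite QP.
Qed.

End projection_theorem.

(** * Square roots and inverses of positive operators *)

Lemma addrDBl (V : zmodType) (a b c : V) : (a + b) - (a + c) = b - c.
Proof. by rewrite opprD addrACA subrr add0r. Qed.

Section positive_operators.
Context {R : realType} {H : hilbertType R}.
Implicit Types (A B C D G N V y r : bop H).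

(** Dominating increments by those of a convergent scalar sequence gives the limit together with the
    explicit remainder [lb - b n]. The square-root iteration, the Neumann series, the exponential
    and the logarithm all converge this way. *)
Lemma bop_cvg_majorized (u : nat -> bop H) (b : nat -> R) (lb : R) :
  (forall n, `|u n.+1 - u n| <= b n.+1 - b n) -> b @ \oo --> lb ->
  exists l, u @ \oo --> l /\ forall n, `|l - u n| <= lb - b n.
Proof.
move=> ub bl.
have ubD n k : `|u (n + k)%N - u n| <= b (n + k)%N - b n.
  elim: k => [|k IH]; first by rewrite addn0 !subrr normr0.
  rewrite addnS -(subrKA (u (n + k)%N)) (le_trans (ler_normD _ _))//.
  by rewrite -[leRHS](subrKA (b (n + k)%N)) lerD.
have b_le n k : b n <= b (n + k)%N.
  by rewrite -subr_ge0 (le_trans _ (ubD n k)).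
have b_lb n : b n <= lb.
  rewrite -(cvg_lim _ bl)//; apply: limr_ge; first exact: cvgP bl.
  by exists n => // m /= nm; rewrite -(subnKC nm).
have /cvg_ex[l ul] : cvg (u @ \oo).
  apply: cauchy_cvg; apply/cauchy_ballP => e e0.
  have [N _ bN] : \forall n \near \oo, `|lb - b n| < e / 2.
    by apply: cvgr_dist_lt bl _ _; rewrite divr_gt0.
  have uN n : (N <= n)%N -> `|u N - u n| < e / 2.
    move=> /subnKC <-; rewrite distrC (le_lt_trans (ubD _ _))//.
    by rewrite (le_lt_trans _ (bN N (leqnn N)))// ger0_norm ?subr_ge0// lerB.
  exists (u @` [set n | (N <= n)%N], u @` [set n | (N <= n)%N]) => /=.
    by split; exists N => // n Nn; exists n.
  move=> [_ _] /= [[n Nn <-] [m Nm <-]]; rewrite -ball_normE/=.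
  rewrite -(subrKA (u N)) (le_lt_trans (ler_normD _ _))// [ltRHS]splitr.
  by rewrite ltrD ?uN// distrC uN.
exists l; split=> // n.
have c1 : (fun m => `|u m - u n|) @ \oo --> `|l - u n|.
  by apply: cvg_norm; apply: cvgB => //; exact: cvg_cst.
rewrite -(cvg_lim _ c1)//; apply: limr_le; first exact: cvgP c1.
exists n => // m /= nm; rewrite -(subnKC nm) (le_trans (ubD _ _))//.
by rewrite lerB.
Qed.

Lemma rdot_bop_le A x : rdot (A x) x <= `|A| * hnorm x ^+ 2.
Proof.
by rewrite (le_trans (rdot_le _ _))// expr2 mulrA ler_wpM2r ?hnorm_ge0// hnorm_bop.
Qed.

Lemma pos1B A : `|A| <= 1 -> pos (1 - A).
Proof.
move=> A1 x; rewrite bopB rdotBl subr_ge0 (le_trans (rdot_bop_le _ _))//.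
by rewrite rdotxx ler_piMl ?sqr_ge0.
Qed.

Lemma posZ (k : R) A : 0 <= k -> pos A -> pos (k *: A).
Proof. by move=> k0 pA x; rewrite bopZ rdotZl mulr_ge0. Qed.

Lemma pos_sqr A : is_adjoint A A -> pos (A * A).
Proof. by move=> /is_adjointP sA x; rewrite bopM sA rdotxx_ge0. Qed.

Lemma norm_le_form (q : R) N : 0 <= q -> is_adjoint N N -> pos N ->
  (forall x, rdot (N x) x <= q * hnorm x ^+ 2) -> `|N| <= q.
Proof.
move=> q0 sN pN Nq; apply: bop_norm_le => // x.
rewrite -(@ler_pXn2r _ 2) ?nnegrE ?mulr_ge0 ?hnorm_ge0//.
by rewrite (le_trans (form_bound_norm q0 sN pN Nq x))// exprMn expr2 -mulrA ler_wpM2l.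
Qed.

(** A fixed point [r] of this iteration satisfies [(1 - r)^2 = 1 - y], so the limit is [1] minus a
    square root of [1 - y]. *)
Fixpoint sqrt_iter (y : bop H) (n : nat) : bop H :=
  if n is m.+1 then 2^-1 *: (y + sqrt_iter y m * sqrt_iter y m) else 0.

Fixpoint sqrt_iterR (n : nat) : R :=
  if n is m.+1 then 2^-1 * (1 + sqrt_iterR m ^+ 2) else 0.

Lemma sqrt_iterS y n :
  sqrt_iter y n.+1 = 2^-1 *: (y + sqrt_iter y n * sqrt_iter y n).
Proof. by []. Qed.

Lemma sqrt_iterRS n : sqrt_iterR n.+1 = 2^-1 * (1 + sqrt_iterR n ^+ 2).
Proof. by []. Qed.

Lemma sqrt_iterR_itv n : 0 <= sqrt_iterR n <= 1.
Proof. by elim: n => [|n /andP[h0 h1]] /=; [lra|nra]. Qed.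

Lemma sqrt_iterR_nd : nondecreasing_seq sqrt_iterR.
Proof.
apply/nondecreasing_seqP => n; have := sqrt_iterR_itv n => /andP[_ h].
by rewrite /=; nra.
Qed.

Lemma comm_sqrt_iter V y n : V * y = y * V ->
  V * sqrt_iter y n = sqrt_iter y n * V.
Proof.
move=> Vy; elim: n => [|n IH] /=; first by rewrite mulr0 mul0r.
rewrite -bop_scalerAr -bop_scalerAl; congr (_ *: _).
by rewrite mulrDr mulrDl Vy mulrA IH -mulrA IH mulrA.
Qed.

Lemma sqrt_iter_norm y n : `|y| <= 1 -> `|sqrt_iter y n| <= sqrt_iterR n.
Proof.
move=> y1; elim: n => [|n IH] /=; first by rewrite normr0.
rewrite normrZ ger0_norm// ler_pM2l// (le_trans (ler_normD _ _))// lerD//.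
by rewrite (le_trans (bop_normM _ _))// expr2 ler_pM.
Qed.

(* The iterates are polynomials in [y] with nonnegative coefficients, so their
   increments are dominated by those of the scalar iteration at [y = 1]. *)
Lemma sqrt_iter_majorized y n : `|y| <= 1 ->
  `|sqrt_iter y n.+1 - sqrt_iter y n| <= sqrt_iterR n.+1 - sqrt_iterR n.
Proof.
move=> y1; elim: n => [|n IH].
  by rewrite /= mulr0 subr0 addr0 normrZ ger0_norm// expr0n/= addr0 subr0 ler_pM2l.
have Vr : sqrt_iter y n.+1 * sqrt_iter y n = sqrt_iter y n * sqrt_iter y n.+1.
  by apply/comm_sqrt_iter/esym/comm_sqrt_iter.
rewrite [sqrt_iter y n.+2]sqrt_iterS [X in _ - X]sqrt_iterS -scalerBr addrDBl.
rewrite [sqrt_iterR n.+2]sqrt_iterRS [X in _ <= _ - X]sqrt_iterRS -mulrBr addrDBl.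
have -> : sqrt_iter y n.+1 * sqrt_iter y n.+1 - sqrt_iter y n * sqrt_iter y n =
    (sqrt_iter y n.+1 - sqrt_iter y n) * (sqrt_iter y n.+1 + sqrt_iter y n).
  by rewrite mulrDr !mulrBl Vr addrA subrK.
rewrite subr_sqr normrZ ger0_norm// ler_pM2l// (le_trans (bop_normM _ _))//.
by rewrite ler_pM// (le_trans (ler_normD _ _))// lerD// sqrt_iter_norm.
Qed.

(** [D = 1 - r] with [r] the limit of the iterates; it is nonnegative because [|r| <= 1]. Each
    iterate is a polynomial in [y], whence the commutation clause. *)
Lemma sqrt_contraction y : is_adjoint y y -> `|y| <= 1 ->
  exists D, [/\ is_adjoint D D, pos D, D * D = 1 - y &
    forall V, V * y = y * V -> V * D = D * V].
Proof.
move=> sy y1.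
have : cvgn sqrt_iterR.
  apply: (nondecreasing_is_cvgn sqrt_iterR_nd); exists 1 => _ [n _ <-].
  by case/andP: (sqrt_iterR_itv n).
move=> /cvg_ex[l Rl].
have [r [rl _]] := bop_cvg_majorized (fun n => sqrt_iter_majorized n y1) Rl.
have sr : is_adjoint r r.
  apply: (is_adjoint_lim _ rl rl) => n; elim: n => [|n IH] /=.
    by apply/is_adjointP => u v; rewrite rdot0l rdot0r.
  by apply: adjZ; apply: adjD => //; exact: adjM.
have r1 : `|r| <= 1.
  have c1 : (fun n => `|sqrt_iter y n|) @ \oo --> `|r| by exact: cvg_norm.
  rewrite -(cvg_lim _ c1)//; apply: limr_le.
    exact: cvgP c1.
  apply: nearW => n; rewrite (le_trans (sqrt_iter_norm _ y1))//.
  by case/andP: (sqrt_iterR_itv n).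
have rE : r = 2^-1 *: (y + r * r).
  have c1 : (fun n => sqrt_iter y n.+1) @ \oo --> r by rewrite cvg_shiftS.
  apply: (cvg_unique _ c1) => //=.
  apply: cvgZr; apply: cvgD; first exact: cvg_cst.
  exact: bop_cvgM.
exists (1 - r); split.
- exact: adjB adj1 sr.
- exact: pos1B.
- have rrE : r * r = 2 *: r - y.
    by rewrite [X in 2 *: X]rE scalerA mulfV// scale1r addrAC subrr add0r.
  rewrite mulrBl mul1r mulrBr mulr1 rrE scaler_nat mulr2n.
  have -> : r - (r + r - y) = y - r.
    by rewrite -[r + r - y]addrA opprD addrA subrr add0r opprB.
  by rewrite opprB subrKA.
- move=> V Vy; rewrite mulrBl mulrBr mul1r mulr1; congr (_ - _).
  have c1 : (fun n => V * sqrt_iter y n) @ \oo --> V * r.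
    by apply: bop_cvgM => //; exact: cvg_cst.
  apply: (cvg_unique _ c1) => //.
  rewrite (_ : (fun n => _) = fun n => sqrt_iter y n * V).
    by apply: bop_cvgM => //; exact: cvg_cst.
  by apply/funext => n; exact: comm_sqrt_iter.
Qed.

Lemma psqrt_exists G : is_adjoint G G -> pos G ->
  exists D, [/\ is_adjoint D D, pos D, D * D = G &
    forall V, V * G = G * V -> V * D = D * V].
Proof.
(* Rescaling by [c] brings [G] between 0 and 1, so that [y = 1 - G / c] is a contraction; the [+ 1]
   covers [G = 0]. *)
move=> sG pG; pose c : R := `|G| + 1; have c0 : 0 < c by rewrite ltr_wpDl.
have cN0 : c != 0 by rewrite gt_eqF.
pose y := 1 - c^-1 *: G.
have sy : is_adjoint y y by apply: (adjB adj1); exact: adjZ.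
have y1 : `|y| <= 1.
  apply: norm_le_form => // [|x].
    apply: pos1B; rewrite normrZ gtr0_norm ?invr_gt0// mulrC ler_pdivrMr// mul1r.
    by rewrite lerDl.
  rewrite bopB bop1 bopZ rdotBl rdotxx rdotZl mul1r gerBl mulr_ge0//.
  by rewrite invr_ge0 ltW.
have [D [sD pD DD cD]] := sqrt_contraction sy y1.
exists (Num.sqrt c *: D); split.
- exact: adjZ.
- by apply: posZ => //; exact: sqrtr_ge0.
- rewrite -bop_scalerAl -bop_scalerAr scalerA -expr2 sqr_sqrtr ?ltW// DD /y.
  by rewrite opprB addrC subrK scalerA mulfV// scale1r.
- move=> V VG; rewrite -bop_scalerAl -bop_scalerAr cD//.
  by rewrite /y mulrBl mulrBr mul1r mulr1 -bop_scalerAl -bop_scalerAr VG.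
Qed.

(** For commuting nonnegative roots [A], [B] and [X = A - B], [(A + B) X = 0] makes both nonnegative
    forms vanish on the range of [X]; hence [A X = B X = 0], so [X^2 = 0] and [X = 0]. *)
Lemma psqrt_uniq C D : is_adjoint C C -> is_adjoint D D -> pos C -> pos D ->
  C * C = D * D -> C = D.
Proof.
move=> sC sD pC pD CD.
(* [C] and [D] are not known to commute, so each is compared with the root from [psqrt_exists],
   which commutes with both. *)
suff h A : is_adjoint A A -> pos A -> forall B, is_adjoint B B -> pos B ->
    B * B = A * A -> (forall V, V * (A * A) = A * A * V -> V * B = B * V) -> A = B.
  have [B [sB pB BB cB]] := psqrt_exists (adjM sC sC) (pos_sqr sC).
  rewrite (h C sC pC B sB pB BB cB); rewrite CD in BB cB.
  by rewrite (h D sD pD B sB pB BB cB).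
move=> {C D sC sD pC pD CD} sA pA B sB pB BB cB.
have AB : A * B = B * A by apply: cB; rewrite mulrA.
pose X := A - B; have sX : is_adjoint X X by exact: adjB.
have ABX : (A + B) * X = 0.
  by rewrite /X mulrDl !mulrBr BB AB addrA subrK subrr.
have XAX x : rdot (A (X x)) (X x) = 0 /\ rdot (B (X x)) (X x) = 0.
  have : rdot (((A + B) * X) x) (X x) = 0 by rewrite ABX rdot0l.
  rewrite bopM bopD rdotDl => /eqP.
  by rewrite paddr_eq0 ?pA ?pB// => /andP[/eqP -> /eqP ->].
have vanish C : is_adjoint C C -> pos C -> (forall x, rdot (C (X x)) (X x) = 0) ->
    forall x, C (X x) = 0.
  move=> sC pC CX x; apply: rdotxx_eq0; have := form_CS (X x) (C (X x)) sC pC.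
  rewrite CX mul0r => h; apply/eqP; rewrite -sqrf_eq0 eq_le h sqr_ge0//.
have X2 x : X (X x) = 0.
  rewrite {1}/X bopB (vanish A)// ?(vanish B)// ?subrr// => z.
    by case: (XAX z).
  by case: (XAX z).
apply/bop_ext => x; apply/eqP; rewrite -subr_eq0; apply/eqP/rdotxx_eq0.
rewrite -bopB -/X; have /is_adjointP -> := sX.
by rewrite X2 rdot0r.
Qed.

Definition coercive A := exists2 d : R, 0 < d & forall x, d * hnorm x ^+ 2 <= rdot (A x) x.

Lemma coercive_pos A : coercive A -> pos A.
Proof. by case=> d d0 h x; rewrite (le_trans _ (h x))// mulr_ge0 ?sqr_ge0// ltW. Qed.

(** Neumann series: with [c = |A| + d], one has [A = c (1 - N)] where [0 <= N <= q] and
    [q = 1 - d / c < 1]. *)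
Lemma coercive_inv A : is_adjoint A A -> coercive A ->
  exists G, A * G = 1 /\ G * A = 1.
Proof.
move=> sA cA; have pA := coercive_pos cA; have [d d0 Ad] := cA.
pose c : R := `|A| + d; have c0 : 0 < c by rewrite ltr_wpDl.
pose q := 1 - d / c; pose N := 1 - c^-1 *: A.
have q0 : 0 <= q by rewrite subr_ge0 ler_pdivrMr// mul1r lerDr.
have q1 : q < 1 by rewrite ltrBlDr ltrDl divr_gt0.
have Nq : `|N| <= q.
  apply: norm_le_form => //.
  - by apply: (adjB adj1); exact: adjZ.
  - apply: pos1B; rewrite normrZ gtr0_norm ?invr_gt0// mulrC ler_pdivrMr// mul1r.
    by rewrite lerDl ltW.
  - move=> x; rewrite bopB bop1 bopZ rdotBl rdotxx rdotZl mulrBl mul1r.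
    by rewrite lerD2l lerN2 mulrAC mulrC ler_pM2l ?invr_gt0.
have AE : A = c *: (1 - N).
  by rewrite /N opprB addrC subrK scalerA mulfV ?gt_eqF// scale1r.
clearbody N; pose g := fix g n := if n is m.+1 then 1 + N * g m else 0 : bop H.
have gN n : N * g n = g n * N.
  elim: n => [|n IH]; first by rewrite mulr0 mul0r.
  rewrite [g n.+1]/(1 + N * g n) mulrDr mulrDl mulr1 mul1r.
  by rewrite {1}IH mulrA.
(* The right-hand side is [q ^+ n], written as an increment of [- q ^+ n / (1 - q)] to fit
   [bop_cvg_majorized]. *)
have gq n : `|g n.+1 - g n| <= - q ^+ n.+1 / (1 - q) - - q ^+ n / (1 - q).
  have -> : - q ^+ n.+1 / (1 - q) - - q ^+ n / (1 - q) = q ^+ n.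
    by rewrite exprS; field; rewrite subr_eq0 gt_eqF.
  elim: n => [|n IH]; first by rewrite /= mulr0 addr0 subr0 expr0 bop_norm1.
  rewrite [g n.+2]/(1 + N * g n.+1) [X in _ - X]/(1 + N * g n) addrDBl -mulrBr exprS.
  by rewrite (le_trans (bop_normM _ _))// ler_pM.
have bl : (fun n => - q ^+ n / (1 - q)) @ \oo --> (0 : R).
  rewrite -(mul0r (1 - q)^-1) -oppr0; apply: cvgM; last exact: cvg_cst.
  by apply: cvgN; apply: cvg_expr; rewrite ger0_norm.
have [G [Gl _]] := bop_cvg_majorized gq bl.
have GE : G = 1 + N * G.
  have c1 : (fun n => g n.+1) @ \oo --> G by rewrite cvg_shiftS.
  apply: (cvg_unique _ c1) => //=; apply: cvgD; first exact: cvg_cst.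
  by apply: bop_cvgM => //; exact: cvg_cst.
have NG : N * G = G * N.
  have c1 : (fun n => N * g n) @ \oo --> N * G.
    by apply: bop_cvgM => //; exact: cvg_cst.
  apply: (cvg_unique _ c1) => //.
  rewrite (_ : (fun n => _) = fun n => g n * N); last exact/funext.
  by apply: bop_cvgM => //; exact: cvg_cst.
have NG1 : (1 - N) * G = 1 by rewrite mulrBl mul1r {1}GE addrK.
exists (c^-1 *: G); rewrite AE -!bop_scalerAl -!bop_scalerAr !scalerA.
rewrite mulfV ?mulVf ?gt_eqF// !scale1r NG1; split=> //.
by rewrite mulrBr mulr1 -NG -{1}(mul1r G) -mulrBl.
Qed.

End positive_operators.

(** * The exponential *)

Section triangular_sums.
Context {V : zmodType}.
Implicit Types (F : nat -> nat -> V) (n : nat).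

Lemma sum_diagonals F n :
  \sum_(0 <= k < n) \sum_(0 <= i < k.+1) F i (k - i)%N =
  \sum_(0 <= i < n) \sum_(0 <= j < n - i) F i j.
Proof.
elim: n => [|n IH]; first by rewrite !big_geq.
rewrite big_nat_recr//= IH [RHS]big_nat_recr//= subSnn big_nat1.
rewrite [\sum_(0 <= i < n.+1) F i (n - i)%N]big_nat_recr//= subnn addrA.
congr (_ + _); rewrite -big_split/=; apply: eq_big_nat => i /andP[_ ni].
by rewrite subSn 1?ltnW// big_nat_recr.
Qed.

(** The error of a truncated Cauchy product as an explicit sum. It holds in any abelian group, so
    operator and scalar errors can be compared term by term. *)
Lemma sum_square_diagonals F n :
  \sum_(0 <= i < n) \sum_(0 <= j < n) F i j -
  \sum_(0 <= k < n) \sum_(0 <= i < k.+1) F i (k - i)%N =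
  \sum_(0 <= i < n) \sum_(n - i <= j < n) F i j.
Proof.
rewrite sum_diagonals -sumrB; apply: eq_bigr => i _.
by rewrite (@big_cat_nat _ _ _ (n - i)) ?leq_subr//= addrAC subrr add0r.
Qed.

End triangular_sums.

Section exponential.
Context {R : realType} {H : hilbertType R}.
Implicit Types (A B Y V : bop H) (s t h : R).

Definition exp_sum A n : bop H := \sum_(0 <= k < n) k`!%:R^-1 *: A ^+ k.
Definition expR_sum (x : R) n : R := \sum_(0 <= k < n) k`!%:R^-1 * x ^+ k.

Lemma exp_bopE A : exp_bop A = limn (exp_sum A).
Proof.
congr (lim (_ @ \oo)); apply/funext => n; rewrite /series/=.
apply: eq_bigr => k _; congr (_ *: _).
by elim: k => // k IH; rewrite iterS IH exprS.
Qed.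

Lemma expR_sumP x : expR_sum x @ \oo --> expR x.
Proof.
have -> : expR_sum x = series (exp_coeff x).
  apply/funext => n; apply: eq_bigr => k _.
  by rewrite /exp_coeff/= mulrC.
exact: is_cvg_series_exp_coeff.
Qed.

Lemma exp_sumS A n : exp_sum A n.+1 = exp_sum A n + n`!%:R^-1 *: A ^+ n.
Proof. by rewrite /exp_sum big_nat_recr. Qed.

Lemma expR_sumS x n : expR_sum x n.+1 = expR_sum x n + n`!%:R^-1 * x ^+ n.
Proof. by rewrite /expR_sum big_nat_recr. Qed.

Lemma expR_sumB x n : expR_sum x n.+1 - expR_sum x n = n`!%:R^-1 * x ^+ n.
Proof. by rewrite expR_sumS addrC addKr. Qed.

Lemma fact_inv_ge0 n : 0 <= n`!%:R^-1 :> R.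
Proof. by rewrite invr_ge0 ler0n. Qed.

Lemma exp_sum_majorized A n :
  `|exp_sum A n.+1 - exp_sum A n| <= expR_sum `|A| n.+1 - expR_sum `|A| n.
Proof.
rewrite exp_sumS expR_sumB addrC addKr normrZ ger0_norm ?fact_inv_ge0//.
by rewrite ler_wpM2l ?fact_inv_ge0// bop_normX.
Qed.

Lemma exp_sumP A : exp_sum A @ \oo --> exp_bop A.
Proof.
rewrite exp_bopE.
have [l [lA _]] := bop_cvg_majorized (exp_sum_majorized A) (@expR_sumP `|A|).
exact: cvgP lA.
Qed.

(** Powers intertwine and the relation passes to the limit. [B = A] yields commutation; [B = - A]
    handles a symmetry anticommuting with the generator. *)
Lemma exp_bop_intertwine A B V : V * A = B * V -> V * exp_bop A = exp_bop B * V.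
Proof.
move=> VAB.
have c1 : (fun n => V * exp_sum A n) @ \oo --> V * exp_bop A.
  by apply: bop_cvgM; [exact: cvg_cst|exact: exp_sumP].
apply: (cvg_unique _ c1) => //.
rewrite (_ : (fun n => _) = fun n => exp_sum B n * V).
  by apply: bop_cvgM; [exact: exp_sumP|exact: cvg_cst].
apply/funext => n; rewrite mulr_sumr mulr_suml; apply: eq_bigr => k _.
rewrite -bop_scalerAr -bop_scalerAl; congr (_ *: _).
elim: k => [|k IH]; first by rewrite mulr1 mul1r.
by rewrite !exprS mulrA VAB -mulrA IH mulrA.
Qed.

Lemma exp_bop_adj A B : is_adjoint A B -> is_adjoint (exp_bop A) (exp_bop B).
Proof.
move=> AB; apply: (is_adjoint_lim _ (@exp_sumP A) (@exp_sumP B)) => n.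
elim: n => [|n IH].
  rewrite /exp_sum !big_geq//; apply/is_adjointP => u v.
  by rewrite rdot0l rdot0r.
by rewrite !exp_sumS; apply: adjD => //; apply: adjZ; exact: adjX.
Qed.

Lemma exp_bop0 : exp_bop (0 : bop H) = 1.
Proof.
have c1 : (fun n => exp_sum 0 n.+1) @ \oo --> exp_bop 0.
  by rewrite cvg_shiftS; exact: exp_sumP.
apply: (cvg_unique _ c1) => //.
rewrite (_ : (fun n => _) = fun=> 1); first exact: cvg_cst.
apply/funext => n; rewrite /exp_sum big_nat_recl//= fact0 invr1 scale1r expr0.
by rewrite big1 ?addr0// => k _; rewrite exprS mul0r scaler0.
Qed.

Lemma fact_binomial s t n : n`!%:R^-1 * (s + t) ^+ n =
  \sum_(0 <= i < n.+1) (i`!%:R^-1 * s ^+ i) * ((n - i)`!%:R^-1 * t ^+ (n - i)).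
Proof.
rewrite addrC exprDn mulr_sumr big_mkord; apply: eq_bigr => i _.
rewrite -mulr_natr -(bin_fact (leq_ord i)) !natrM.
have fN0 k : k`!%:R != 0 :> R by rewrite pnatr_eq0 -lt0n fact_gt0.
have bN0 : ('C(n, i))%:R != 0 :> R by rewrite pnatr_eq0 -lt0n bin_gt0 leq_ord.
by field; rewrite !fN0 bN0.
Qed.

Lemma exp_sum_mul Y s t n :
  exp_sum (s *: Y) n * exp_sum (t *: Y) n - exp_sum ((s + t) *: Y) n =
  \sum_(0 <= i < n) \sum_(n - i <= j < n)
     (i`!%:R^-1 * s ^+ i * (j`!%:R^-1 * t ^+ j)) *: Y ^+ (i + j).
Proof.
have expZ r k : (r *: Y) ^+ k = r ^+ k *: Y ^+ k.
  elim: k => [|k IH]; first by rewrite !expr0 scale1r.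
  by rewrite !exprS IH -bop_scalerAl -bop_scalerAr scalerA.
rewrite -sum_square_diagonals; congr (_ - _).
  rewrite mulr_suml; apply: eq_bigr => i _; rewrite mulr_sumr.
  apply: eq_bigr => j _; rewrite !expZ !scalerA -bop_scalerAl -bop_scalerAr.
  by rewrite scalerA exprD.
apply: eq_bigr => k _; rewrite expZ scalerA fact_binomial scaler_suml.
apply: eq_big_nat => i /andP[_ ik]; by rewrite subnKC.
Qed.

Lemma expR_sum_mul x s t n :
  expR_sum (s * x) n * expR_sum (t * x) n - expR_sum ((s + t) * x) n =
  \sum_(0 <= i < n) \sum_(n - i <= j < n)
     (i`!%:R^-1 * s ^+ i * (j`!%:R^-1 * t ^+ j)) * x ^+ (i + j).
Proof.
rewrite -sum_square_diagonals; congr (_ - _).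
  rewrite mulr_suml; apply: eq_bigr => i _; rewrite mulr_sumr.
  by apply: eq_bigr => j _; rewrite !exprMn exprD; ring.
apply: eq_bigr => k _; rewrite exprMn mulrA fact_binomial mulr_suml.
apply: eq_big_nat => i /andP[_ ik]; by rewrite subnKC.
Qed.

(** The Cauchy product error is dominated, term by term, by the scalar error at [|s|], [|t|] and
    [|Y|], which tends to 0 by the scalar law [expRD]. *)
Lemma exp_bopD Y s t :
  exp_bop ((s + t) *: Y) = exp_bop (s *: Y) * exp_bop (t *: Y).
Proof.
have c1 : (fun n => exp_sum (s *: Y) n * exp_sum (t *: Y) n) @ \oo -->
    exp_bop (s *: Y) * exp_bop (t *: Y) by apply: bop_cvgM; exact: exp_sumP.
apply/esym; apply: (cvg_unique _ c1) => //.
pose d n := exp_sum (s *: Y) n * exp_sum (t *: Y) n - exp_sum ((s + t) *: Y) n.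
suff d0 : d @ \oo --> (0 : bop H).
  rewrite (_ : (fun n => _) = fun n => d n + exp_sum ((s + t) *: Y) n).
    rewrite -[exp_bop _]add0r; apply: cvgD => //; exact: exp_sumP.
  by apply/funext => n; rewrite /d subrK.
apply/norm_cvg0P; pose x := `|Y|.
apply: (@squeeze_cvgr _ _ _ _ (fun=> 0) (fun n =>
  expR_sum (`|s| * x) n * expR_sum (`|t| * x) n - expR_sum ((`|s| + `|t|) * x) n)).
- near=> n; rewrite normr_ge0/= /d exp_sum_mul expR_sum_mul.
  rewrite (le_trans (ler_norm_sum _ _ _))//; apply: ler_sum => i _.
  rewrite (le_trans (ler_norm_sum _ _ _))//; apply: ler_sum => j _.
  rewrite normrZ !normrM !normrX !(ger0_norm (fact_inv_ge0 _)).
  by rewrite ler_wpM2l ?bop_normX// !mulr_ge0 ?fact_inv_ge0 ?exprn_ge0.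
- exact: cvg_cst.
- have <- : expR (`|s| * x) * expR (`|t| * x) - expR ((`|s| + `|t|) * x) = 0.
    by rewrite mulrDl expRD subrr.
  apply: cvgB; last exact: expR_sumP.
  by apply: cvgM; exact: expR_sumP.
Unshelve. all: by end_near. Qed.

Lemma exp_bopNM Y s : exp_bop (- s *: Y) * exp_bop (s *: Y) = 1.
Proof. by rewrite -exp_bopD addNr scale0r exp_bop0. Qed.

Lemma exp_bopMN Y s : exp_bop (s *: Y) * exp_bop (- s *: Y) = 1.
Proof. by rewrite -exp_bopD subrr scale0r exp_bop0. Qed.

(** Each term of order [k >= 2] is at most [h^2 |Y|^k / k!], so the tail is dominated by [h^2] times
    the scalar exponential series. *)
Lemma exp_bop_taylor1 Y h : `|h| <= 1 ->
  `|exp_bop (h *: Y) - 1 - h *: Y| <= expR `|Y| * h ^+ 2.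
Proof.
move=> h1.
have fS n : `|exp_sum (h *: Y) n.+3 - exp_sum (h *: Y) n.+2| <=
    h ^+ 2 * expR_sum `|Y| n.+3 - h ^+ 2 * expR_sum `|Y| n.+2.
  rewrite (le_trans (exp_sum_majorized _ _))// -mulrBr !expR_sumB.
  rewrite normrZ exprMn mulrCA.
  apply: ler_wpM2r; first by rewrite mulr_ge0 ?fact_inv_ge0 ?exprn_ge0.
  rewrite -(real_normK (num_real h)).
  by rewrite -addn2 exprD ler_piMl ?exprn_ge0// exprn_ile1.
have bl : (fun n => h ^+ 2 * expR_sum `|Y| n.+2) @ \oo --> h ^+ 2 * expR `|Y|.
  apply: cvgM; first exact: cvg_cst.
  rewrite (cvg_shiftS (fun n => expR_sum `|Y| n.+1)) cvg_shiftS.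
  exact: expR_sumP.
have [l [ll /(_ 0%N)]] := bop_cvg_majorized fS bl.
have -> : l = exp_bop (h *: Y).
  have c2 : (fun n => exp_sum (h *: Y) n.+2) @ \oo --> exp_bop (h *: Y).
    rewrite (cvg_shiftS (fun n => exp_sum (h *: Y) n.+1)) cvg_shiftS.
    exact: exp_sumP.
  exact: (cvg_unique _ ll c2).
rewrite !exp_sumS /exp_sum big_geq// add0r !factE invr1 !scale1r expr0 expr1.
rewrite opprD addrA => /le_trans; apply; rewrite mulrC gerBl mulr_ge0 ?sqr_ge0//.
by rewrite /expR_sum sumr_ge0// => i _; rewrite mulr_ge0 ?fact_inv_ge0 ?exprn_ge0.
Qed.

Lemma exp_bop_cts Y : continuous (fun t => exp_bop (t *: Y)).
Proof.
move=> t; apply/subr_cvg0/norm_cvg0P.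
pose C := `|exp_bop (t *: Y)| * (expR `|Y| + `|Y|).
apply: (@squeeze_cvgr _ _ _ _ (fun=> 0) (fun u => C * `|u - t|)).
- near=> u; rewrite normr_ge0/=; have ut : `|u - t| <= 1.
    near: u; apply: cvgr_distC_le; first exact: cvg_id.
    exact: ltr01.
  have -> : exp_bop (u *: Y) - exp_bop (t *: Y) =
      exp_bop (t *: Y) * (exp_bop ((u - t) *: Y) - 1).
    by rewrite mulrBr mulr1 -exp_bopD [t + _]addrC subrK.
  rewrite (le_trans (bop_normM _ _))// /C -mulrA ler_wpM2l//.
  rewrite -[exp_bop _ - 1](subrK ((u - t) *: Y)) (le_trans (ler_normD _ _))//.
  rewrite mulrDl lerD//; last by rewrite normrZ mulrC.
  rewrite (le_trans (exp_bop_taylor1 _ ut))// ler_wpM2l ?expR_ge0//.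
  by rewrite -real_normK ?num_real// expr2 ler_piMl.
- exact: cvg_cst.
- have h0 : (fun u : R => `|u - t|) @ t --> (0 : R).
    by apply/norm_cvg0P/subr_cvg0 => B.
  have h1 : (fun u : R => C * `|u - t|) @ t --> C * 0.
    by apply: cvgM; [exact: cvg_cst|exact: h0].
  by rewrite mulr0 in h1.
Unshelve. all: by end_near. Qed.

End exponential.

(** * Symmetries, signs and midpoints *)

Section symmetries.
Context {R : realType} {H : hilbertType R}.
Implicit Types (A D E F P e : bop H) (x : H).

Lemma bop_continuous A : continuous A.
Proof.
move=> x; apply/cvgrPdist_lt => e e0.
have er : e = ((complex.Re e)%:C)%C by rewrite RRe_real// gtr0_real.
have re0 : 0 < complex.Re e by rewrite -ltcR -er.
have d0 : 0 < complex.Re e / (`|A| + 1) by rewrite divr_gt0// ltr_wpDl.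
have dC : (0 : R[i]) < (complex.Re e / (`|A| + 1))%:C%C by rewrite ltcR.
have := nbhsx_ballx x _ dC; apply: filterS => y.
rewrite -ball_normE/= hnormE ltcR => xy.
rewrite -linearB hnormE er ltcR (le_lt_trans (hnorm_bop _ _))//.
rewrite (@le_lt_trans _ _ (`|A| * (complex.Re e / (`|A| + 1))))//.
  by rewrite ler_wpM2l// ltW.
by rewrite mulrCA gtr_pMr// ltr_pdivrMr ?ltr_wpDl// mul1r ltrDl.
Qed.

Lemma closed_kernel A : closed [set x | A x = 0].
Proof.
have -> : [set x | A x = 0] = A @^-1` [set 0] by [].
apply: preimage_closed; first by move=> x _; exact: bop_continuous.
exact/accessible_closed_set1/hausdorff_accessible/norm_hausdorff.
Qed.

Definition injective_op A := forall x, A x = 0 -> x = 0.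

Lemma injective_opM A D E : injective_op A -> A * D = A * E -> D = E.
Proof.
move=> iA ADE; apply/bop_ext => x; apply/eqP; rewrite -subr_eq0; apply/eqP.
by apply: iA; rewrite linearB/= -!bopM ADE subrr.
Qed.

Definition symmetry_of P : bop H := 2 *: P - 1.

Lemma symmetry_adj P : is_adjoint P P ->
  is_adjoint (symmetry_of P) (symmetry_of P).
Proof. by move=> sP; apply: adjB => //; exact: adjZ. Qed.

Lemma symmetry_sqr P : P * P = P -> symmetry_of P * symmetry_of P = 1.
Proof.
move=> PP; rewrite /symmetry_of scaler_nat mulr2n.
rewrite mulrBl mulrBr mulr1 mul1r mulrDl !mulrDr PP addrK.
by rewrite opprB addrCA subrr addr0.
Qed.

(* [Q] projects onto the kernel of [|A| - A], on whose orthogonal complement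
   [A = - |A|]. *)
Lemma sign_exists A : is_adjoint A A -> injective_op A ->
  exists e D, [/\ is_adjoint e e, e * e = 1, is_adjoint D D, pos D &
    [/\ D * D = A * A, D * e = A, injective_op D &
        forall V, V * (A * A) = A * A * V -> V * D = D * V]].
Proof.
move=> sA iA; have [D [sD pD DD cD]] := psqrt_exists (adjM sA sA) (pos_sqr sA).
have DA : A * D = D * A by apply: cD; rewrite mulrA.
pose N := [set x | (D - A) x = 0].
have [|||Q Qp] := @orthoproj_exists R H N.
- exact: (linear0 (D - A)).
- by move=> a x y Nx Ny; rewrite /N/mkset (bop_linear (D - A)) Nx Ny scaler0 addr0.
- exact: closed_kernel.
have [QQ sQ rQ] := Qp.
have DQ : D * Q = A * Q.
  apply/bop_ext => x; apply/eqP; rewrite -subr_eq0 !bopM -bopB; apply/eqP.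
  by have : N (Q x) by rewrite -rQ; exists x.
have DQ' : (D + A) * (1 - Q) = 0.
  (* [(D - A) (D + A) = 0], so [D + A] maps into the range of [Q]; moving [D + A] across the pairing
     of [z] with itself leaves an element of that range against [(1 - Q) x]. *)
  apply/bop_ext => x; rewrite bop0; apply: rdotxx_eq0.
  set z := ((D + A) * (1 - Q)) x.
  have Nz : N ((D + A) z).
    rewrite /N/mkset -bopM.
    by rewrite mulrBl !mulrDr DD DA [X in _ - X]addrC subrr.
  rewrite {1}/z bopM; have /is_adjointP -> := adjD sD sA.
  rewrite -(orthoproj_fix Qp Nz); have /is_adjointP <- := sQ.
  have QQ' : Q * Q = Q by [].
  by rewrite -bopM mulrBr mulr1 QQ' subrr rdot0l.
exists (symmetry_of Q), D; split=> //.
- exact: symmetry_adj.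
- exact: symmetry_sqr.
split=> //; last by move=> x Dx; apply/iA/iA; rewrite -bopM -DD bopM Dx linear0.
have -> : symmetry_of Q = Q - (1 - Q).
  by rewrite /symmetry_of scaler_nat mulr2n opprB addrA.
have := DQ'; rewrite mulrDl => /eqP; rewrite addr_eq0 => /eqP DQ1.
by rewrite mulrBr DQ1 opprK DQ -mulrDr addrC subrK mulr1.
Qed.

(** [A = e0 + e1] satisfies [A e0 = e1 A] and [A e1 = e0 A], so [D = |A|] commutes with both
    symmetries. As [D] is injective but perhaps not invertible, the relations for the sign [e] are
    proved after multiplying by [D] on the left. *)
Lemma midpoint_exists e0 e1 : is_adjoint e0 e0 -> e0 * e0 = 1 ->
  is_adjoint e1 e1 -> e1 * e1 = 1 -> injective_op (e0 + e1) ->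
  exists e, [/\ is_adjoint e e, e * e = 1, e * e0 * e = e1 & pos (e * e0 + e0 * e)].
Proof.
move=> s0 i0 s1 i1 iA; pose A := e0 + e1.
have sA : is_adjoint A A by exact: adjD.
have [e [D [se ee sD pD [DD De iD cD]]]] := sign_exists sA iA.
have Ae0 : A * e0 = e1 * A by rewrite mulrDl mulrDr i0 i1 addrC.
have Ae1 : A * e1 = e0 * A by rewrite mulrDl mulrDr i0 i1 addrC.
have De0 : e0 * D = D * e0.
  by apply: cD; rewrite -[RHS]mulrA Ae0 [RHS]mulrA Ae1 mulrA.
have De1 : e1 * D = D * e1.
  by apply: cD; rewrite -[RHS]mulrA Ae1 [RHS]mulrA Ae0 mulrA.
exists e; split=> //.
- suff -> : e * e0 = e1 * e by rewrite -mulrA ee mulr1.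
  by apply: (injective_opM iD); rewrite !mulrA De Ae0 -De1 -mulrA De.
- suff -> : e * e0 + e0 * e = D by [].
  apply: (injective_opM iD); rewrite mulrDr !mulrA De -De0 -mulrA De DD.
  have -> : A * A = A * e0 + A * e1 by rewrite -mulrDr.
  by rewrite Ae1.
Qed.

Lemma unitary_norm E Es : is_adjoint E Es -> Es * E = 1 -> forall x, hnorm (E x) = hnorm x.
Proof.
move=> aE EE x; apply/eqP; rewrite -(@eqrXn2 _ 2) ?hnorm_ge0//.
by rewrite (adj_norm aE) -bopM EE rdotxx.
Qed.

Lemma unitary_norm_le1 E Es : is_adjoint E Es -> Es * E = 1 -> `|E| <= 1.
Proof.
by move=> aE EE; apply: bop_norm_le => // x; rewrite (unitary_norm aE EE) mul1r.
Qed.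

(** [(E + Es)^2 = E^2 + Es^2 + 2] depends only on [E^2], so the nonnegative [E + Es] is determined.
    Then [(E + Es) E = E^2 + 1] determines [E], because [E (E + Es) = E^2 + 1] is injective. *)
Lemma unitary_root_uniq E Es F Fs :
  is_adjoint E Es -> E * Es = 1 -> Es * E = 1 -> pos (E + Es) ->
  is_adjoint F Fs -> F * Fs = 1 -> Fs * F = 1 -> pos (F + Fs) ->
  E * E = F * F -> injective_op (E * E + 1) -> E = F.
Proof.
move=> aE EEs EsE pE aF FFs FsF pF EF iE.
have EsFs : Es * Es = Fs * Fs.
  by apply: (adj_uniq (adjM aE aE)); rewrite EF; exact: adjM.
have sD A As : is_adjoint A As -> is_adjoint (A + As) (A + As).
  by move=> aA; rewrite [X in is_adjoint _ X]addrC; apply: adjD => //; exact: adjC.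
have sq A As : A * As = 1 -> As * A = 1 -> (A + As) * (A + As) = A * A + As * As + 1 *+ 2.
  by move=> h h'; rewrite mulrDl !mulrDr h h' mulr2n [1 + As * As]addrC addrACA.
have DD : E + Es = F + Fs.
  apply: psqrt_uniq => //; [exact: sD|exact: sD|].
  by rewrite !sq// EF EsFs.
have DE : (E + Es) * E = E * E + 1 by rewrite mulrDl EsE.
apply: (@injective_opM (E + Es)).
  move=> x Dx; apply: iE.
  have -> : E * E + 1 = E * (E + Es) by rewrite mulrDr EEs.
  by rewrite bopM Dx linear0.
by rewrite DE DD mulrDl FsF EF.
Qed.

Lemma exp_unitary (Y : bop H) t : is_adjoint Y (- Y) ->
  is_adjoint (exp_bop (t *: Y)) (exp_bop (- t *: Y)).
Proof.
by move=> aY; apply: exp_bop_adj; rewrite scaleNr -scalerN; exact: adjZ.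
Qed.

Lemma exp_norm_le1 (Y : bop H) t : is_adjoint Y (- Y) -> `|exp_bop (t *: Y)| <= 1.
Proof.
move=> aY; exact: (unitary_norm_le1 (exp_unitary t aY) (exp_bopNM Y t)).
Qed.

Lemma dist_expn (A B : bop H) n : `|A| <= 1 -> `|B| <= 1 ->
  `|A ^+ n - B ^+ n| <= n%:R * `|A - B|.
Proof.
move=> A1 B1; elim: n => [|n IH]; first by rewrite !expr0 subrr normr0 mul0r.
have -> : A ^+ n.+1 - B ^+ n.+1 = A * (A ^+ n - B ^+ n) + (A - B) * B ^+ n.
  by rewrite !exprS mulrBr mulrBl addrA subrK.
rewrite (le_trans (ler_normD _ _))// -natr1 [leRHS]mulrDl mul1r lerD//.
  by rewrite (le_trans (bop_normM _ _))// (le_trans _ IH)// ler_piMl.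
rewrite (le_trans (bop_normM _ _))// ler_piMr//.
by rewrite (le_trans (bop_normX _ _))// exprn_ile1.
Qed.

End symmetries.

(** * Logarithm from dyadic roots *)

Section dyadic_roots.
Context {R : realType} {H : hilbertType R}.
Context (u us : nat -> bop H).
Context (u_adj : forall n, is_adjoint (u n) (us n)).
Context (u_us : forall n, u n * us n = 1) (us_u : forall n, us n * u n = 1).
Context (u_root : forall n, u n.+1 * u n.+1 = u n).
Context (u_pos : forall n, pos (u n + us n)).
Local Notation half := (2^-1 : R).

Lemma hnorm_u n x : hnorm (u n x) = hnorm x.
Proof. exact: (unitary_norm (@u_adj n) (us_u n)). Qed.

Lemma us_root n : us n.+1 * us n.+1 = us n.
Proof.
by apply: (adj_uniq (adjM (@u_adj n.+1) (@u_adj n.+1))); rewrite u_root.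
Qed.

Lemma rdot_us n x : rdot (us n x) x = rdot (u n x) x.
Proof. by have /is_adjointP -> := @u_adj n; rewrite rdotC. Qed.

(* With [C] the real part of the (n+1)-st root, [0 <= C <= 1] gives
   [C >= C^2 = (1 + Re (u n)) / 2 >= 1 / 2]. *)
Lemma u_coercive n x : hnorm x ^+ 2 <= rdot ((u n.+1 + us n.+1) x) x.
Proof.
set D := u n.+1 + us n.+1; pose C := half *: D.
have sD : is_adjoint D D.
  by rewrite [X in is_adjoint _ X]addrC; apply: adjD => //; exact/adjC/u_adj.
have sC : is_adjoint C C by exact: adjZ.
have pC : pos C by apply: posZ => //; exact: u_pos.
have C1 z : rdot (C z) z <= 1 * hnorm z ^+ 2.
  rewrite /C bopZ rdotZl bopD rdotDl rdot_us.
  by have := rdot_le (u n.+1 z) z; rewrite hnorm_u -expr2; lra.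
have := form_bound_norm ler01 sC pC C1 x.
rewrite mul1r -rdotxx; have /is_adjointP -> := sC.
rewrite rdotC -bopM /C -bop_scalerAl -bop_scalerAr scalerA !bopZ !rdotZl.
have -> : D * D = u n + us n + 1 *+ 2.
  rewrite /D mulrDl !mulrDr u_us us_u u_root us_root mulr2n.
  by rewrite [1 + us n]addrC addrACA.
rewrite (bopD (u n + us n)) rdotDl (mulr2n (1 : bop H)) (bopD 1 1) rdotDl bop1 rdotxx.
by have := @u_pos n x; lra.
Qed.

(** For unitary [v = u n.+1], [|(v + 1) y|^2 = 2 |y|^2 + <(v + us n.+1) y, y>], at least [3 |y|^2]
    by [u_coercive]; apply this to [y = (v - 1) x]. *)
Lemma u_contract n x :
  3 * hnorm ((u n.+1 - 1) x) ^+ 2 <= hnorm ((u n - 1) x) ^+ 2.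
Proof.
have -> : u n - 1 = (u n.+1 + 1) * (u n.+1 - 1).
  by rewrite mulrBr mulr1 mulrDl u_root mul1r addrKA.
rewrite bopM; set y := (u n.+1 - 1) x; rewrite bopD bop1 hnormD_sqr hnorm_u.
by have := u_coercive n y; rewrite bopD rdotDl rdot_us; lra.
Qed.

(** The 4 is the square of the trivial bound [|u 0 - 1| <= 2]. *)
Lemma u_near1 n : `|u n - 1| ^+ 2 <= 4 * (3^-1) ^+ n.
Proof.
have q0 : 0 <= 4 * (3^-1) ^+ n :> R by rewrite mulr_ge0// exprn_ge0.
rewrite -[leRHS]sqr_sqrtr// ler_pXn2r ?nnegrE ?sqrtr_ge0//.
apply: bop_norm_le => [|x]; first exact: sqrtr_ge0.
rewrite -(@ler_pXn2r _ 2) ?nnegrE ?mulr_ge0 ?sqrtr_ge0 ?hnorm_ge0//.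
rewrite exprMn sqr_sqrtr//; elim: n {q0} => [|n IH].
  rewrite expr0 mulr1 bopB bop1 hnormB_sqr hnorm_u.
  have : - hnorm x ^+ 2 <= rdot (u 0%N x) x.
    by have := rdot_CS (u 0%N x) x; rewrite hnorm_u -expr2 ler_norml => /andP[].
  by move: (hnorm x ^+ 2) (rdot _ _) => a b; lra.
have := u_contract n x; rewrite (exprS 3^-1); move: IH.
move: (hnorm ((u n - 1) x) ^+ 2) (hnorm ((u n.+1 - 1) x) ^+ 2) (hnorm x ^+ 2) => a b c.
by move: (3^-1 ^+ n) => d; nra.
Qed.

Lemma adj_u1 n : is_adjoint (u n - 1) (us n - 1).
Proof. exact: adjB. Qed.

Lemma us_norm1 n : `|us n - 1| <= `|u n - 1|.
Proof.
have -> : us n - 1 = us n * (1 - u n) by rewrite mulrBr mulr1 us_u.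
rewrite (le_trans (bop_normM _ _))// distrC ler_piMl//.
exact: (unitary_norm_le1 (adjC (@u_adj n)) (u_us n)).
Qed.

Definition root_slope n := 2 ^+ n *: (u n - 1).

(** With [v = u n.+1], [2 (v - 1) - (v^2 - 1) = - (v - 1)^2]: the first-order terms cancel. *)
Lemma root_slopeB n : root_slope n.+1 - root_slope n =
  - (2 ^+ n *: ((u n.+1 - 1) * (u n.+1 - 1))).
Proof.
rewrite /root_slope exprSr -scalerA -scalerBr -scalerN; congr (_ *: _).
rewrite mulrBr mulr1 mulrBl u_root mul1r scaler_nat mulr2n.
by rewrite -addrA !opprB subrKA.
Qed.

Lemma root_slope_majorized n : `|root_slope n.+1 - root_slope n| <=
  - (4 * (2 / 3) ^+ n.+1) - - (4 * (2 / 3) ^+ n).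
Proof.
rewrite root_slopeB normrN normrZ ger0_norm ?exprn_ge0//.
have h : `|(u n.+1 - 1) * (u n.+1 - 1)| <= 4 * 3^-1 ^+ n.+1.
  by rewrite (le_trans (bop_normM _ _))// -expr2 u_near1.
have -> : - (4 * (2 / 3) ^+ n.+1) - - (4 * (2 / 3) ^+ n) =
    2 ^+ n * (4 * 3^-1 ^+ n.+1) :> R.
  by rewrite !exprS !exprMn; field.
by rewrite ler_wpM2l// exprn_ge0.
Qed.

Lemma cvg_geometric23 (c : R) : (fun n => c * (2 / 3) ^+ n) @ \oo --> (0 : R).
Proof.
have h : (fun n => (2 / 3 : R) ^+ n) @ \oo --> (0 : R).
  by apply: cvg_expr; rewrite ger0_norm//; lra.
have h1 : (fun n => c * (2 / 3 : R) ^+ n) @ \oo --> c * 0.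
  by apply: cvgM; [exact: cvg_cst|exact: h].
by rewrite mulr0 in h1.
Qed.

Lemma cvg_geometric23N : (fun n => - (4 * (2 / 3) ^+ n)) @ \oo --> (0 : R).
Proof. by rewrite -oppr0; apply: cvgN; exact: cvg_geometric23. Qed.

(** The limit is skew because [(u - 1) + (us - 1) = - (us - 1) (u - 1)] is quadratically small.
    Next, [exp (2^-k Y)] and [u k] differ by [2^-k] times a null sequence; for [k = n + m], raising
    these contractions to the power [2^m] multiplies the error by at most [2^m], so it still tends
    to 0 in [m]. *)
Theorem dyadic_log : exists Y, [/\ is_adjoint Y (- Y),
  root_slope @ \oo --> Y & forall n, exp_bop (half ^+ n *: Y) = u n].
Proof.
have [Y [YP Yn]] := bop_cvg_majorized root_slope_majorized cvg_geometric23N.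
have aY : is_adjoint Y (- Y).
  pose sl n := 2 ^+ n *: (us n - 1).
  have slY : sl @ \oo --> - Y.
    suff : (fun n => root_slope n + sl n) @ \oo --> (0 : bop H).
      move=> h; rewrite (_ : sl = fun n => (root_slope n + sl n) - root_slope n).
        by rewrite -[- Y]add0r; exact: (cvgB h YP).
      by apply/funext => n; rewrite addrC addKr.
    apply/norm_cvg0P; apply: (@squeeze_cvgr _ _ _ _ (fun=> 0)
      (fun n => 4 * (2 / 3 : R) ^+ n)); last exact: cvg_geometric23.
      near=> n; rewrite normr_ge0/= -scalerDr.
      have -> : u n - 1 + (us n - 1) = - ((us n - 1) * (u n - 1)).
        rewrite mulrBr mulr1 mulrBl us_u mul1r.
        by rewrite 2!opprB addrC.
      rewrite normrZ normrN ger0_norm ?exprn_ge0// exprMn mulrCA.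
      rewrite ler_wpM2l ?exprn_ge0// (le_trans (bop_normM _ _))//.
      by rewrite (le_trans _ (u_near1 n))// expr2 ler_wpM2r// us_norm1.
    exact: cvg_cst.
  by apply: (is_adjoint_lim _ YP slY) => n; apply: adjZ; exact: adj_u1.
exists Y; split=> // n.
(* [expR |Y|] comes from the Taylor remainder, 4 from the distance between [Y] and
   [root_slope k]. *)
pose K := expR `|Y| + 4.
have hk k : (half ^+ k) * 2 ^+ k = 1 by rewrite -exprMn mulVf// expr1n.
have close k : `|exp_bop (half ^+ k *: Y) - u k| <= half ^+ k * (K * (2 / 3) ^+ k).
  have h0 : 0 <= half ^+ k by rewrite exprn_ge0.
  have -> : u k = 1 + half ^+ k *: root_slope k.
    by rewrite /root_slope scalerA hk scale1r addrC subrK.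
  have -> : exp_bop (half ^+ k *: Y) - (1 + half ^+ k *: root_slope k) =
     (exp_bop (half ^+ k *: Y) - 1 - half ^+ k *: Y) + half ^+ k *: (Y - root_slope k).
    by rewrite scalerBr addrA subrK opprD addrA.
  rewrite (le_trans (ler_normD _ _))// /K mulrDl mulrDr lerD//.
    have h1 : `|half ^+ k| <= 1 by rewrite ger0_norm// exprn_ile1//; lra.
    rewrite (le_trans (exp_bop_taylor1 Y h1))// expr2 mulrCA ler_wpM2l//.
    rewrite ler_wpM2l ?expR_ge0// lerXn2r ?nnegrE//; lra.
  rewrite normrZ ger0_norm// ler_wpM2l// (le_trans (Yn k))//.
  by rewrite opprK add0r.
have expX s m : exp_bop (s *: Y) ^+ m = exp_bop ((m%:R * s) *: Y).
  elim: m => [|m IH]; first by rewrite mul0r scale0r exp_bop0.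
  by rewrite exprSr IH -exp_bopD -natr1 mulrDl mul1r.
have uX m : u (n + m)%N ^+ (2 ^ m) = u n.
  elim: m => [|m IH]; first by rewrite addn0 expr1.
  by rewrite expnS exprM expr2 addnS u_root.
have bound m : `|exp_bop (half ^+ n *: Y) - u n| <= K * (2 / 3) ^+ m.
  have := @dist_expn _ _ (exp_bop (half ^+ (n + m)%N *: Y)) (u (n + m)%N) (2 ^ m)%N
    (exp_norm_le1 _ aY) (unitary_norm_le1 (@u_adj _) (us_u _)).
  have K0 : 0 <= K by rewrite addr_ge0 ?expR_ge0.
  have -> : exp_bop (half ^+ (n + m) *: Y) ^+ (2 ^ m) = exp_bop (half ^+ n *: Y).
    by rewrite expX natrX exprD mulrCA [2 ^+ m * _]mulrC hk mulr1.
  rewrite uX natrX => /le_trans; apply.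
  rewrite (@le_trans _ _ (2 ^+ m * (half ^+ (n + m) * (K * (2 / 3) ^+ (n + m)))))//.
    by rewrite ler_wpM2l ?exprn_ge0.
  have -> : 2 ^+ m * (half ^+ (n + m) * (K * (2 / 3) ^+ (n + m))) =
      half ^+ n * (2 / 3) ^+ n * (K * (2 / 3) ^+ m).
    rewrite -[RHS]mul1r -[X in _ = X * _](hk m) !exprD.
    by move: (half ^+ m) (half ^+ n) (2 ^+ m) ((2 / 3) ^+ n) => *; ring.
  have a1 : half ^+ n <= 1 by rewrite exprn_ile1//; lra.
  have a2 : (2 / 3 : R) ^+ n <= 1 by rewrite exprn_ile1//; lra.
  have a3 : 0 <= half ^+ n by rewrite exprn_ge0.
  have a4 : 0 <= (2 / 3 : R) ^+ n by rewrite exprn_ge0.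
  have a5 : 0 <= K * (2 / 3 : R) ^+ m by rewrite mulr_ge0// exprn_ge0.
  by rewrite ler_piMl// mulr_ile1.
have lim0 : (fun m => K * (2 / 3 : R) ^+ m) @ \oo --> (0 : R).
  exact: cvg_geometric23.
apply/eqP; rewrite -subr_eq0 -normr_le0.
rewrite -(cvg_lim _ lim0)//; apply: limr_ge; first exact: cvgP lim0.
exact: nearW.
Unshelve. all: by end_near. Qed.

End dyadic_roots.

(** * The cosine of a skew-adjoint operator *)

Section operator_cosine.
Context {R : realType} {H : hilbertType R}.
Context (Y : bop H) (Y_skew : is_adjoint Y (- Y)).
Implicit Types (A G : bop H) (s t : R).
Local Notation half := (2^-1 : R).

(** As [Y] is skew-adjoint, this is the self-adjoint part of [exp (t Y)], that is [cos (t B)] if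
    [Y = i B]. *)
Definition op_cos t : bop H := half *: (exp_bop (t *: Y) + exp_bop (- t *: Y)).

Lemma op_cos_adj t : is_adjoint (op_cos t) (op_cos t).
Proof.
apply: adjZ; rewrite [X in is_adjoint _ X]addrC; apply: adjD.
  exact: exp_unitary.
by have := exp_unitary (- t) Y_skew; rewrite opprK.
Qed.

Lemma op_cos0 : op_cos 0 = 1.
Proof.
rewrite /op_cos oppr0 scale0r exp_bop0.
have -> : 1 + 1 = (2 : R) *: (1 : bop H) by rewrite scaler_nat mulr2n.
by rewrite scalerA mulVf// scale1r.
Qed.

Lemma op_cos_comm s t : op_cos s * op_cos t = op_cos t * op_cos s.
Proof.
rewrite /op_cos -!bop_scalerAl -!bop_scalerAr; congr (_ *: (_ *: _)).
by rewrite !mulrDl !mulrDr -!exp_bopD addrACA !(addrC t) !(addrC (- t)).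
Qed.

Lemma op_cosM s t : 2 *: (op_cos s * op_cos t) = op_cos (s + t) + op_cos (s - t).
Proof.
rewrite /op_cos -bop_scalerAl -bop_scalerAr !scalerA mulrA mulfV// mul1r -scalerDr.
congr (_ *: _); rewrite mulrDl !mulrDr -!exp_bopD opprB opprD.
by rewrite [- s + t]addrC [exp_bop ((t - s) *: Y) + _]addrC addrACA.
Qed.

Lemma op_cos_norm t : `|op_cos t| <= 1.
Proof.
rewrite normrZ ger0_norm// ler_pdivrMl// mulr1 (le_trans (ler_normD _ _))//.
have := exp_norm_le1 t Y_skew; have := exp_norm_le1 (- t) Y_skew; lra.
Qed.

Lemma op_cos_le t x : rdot (op_cos t x) x <= 1 * hnorm x ^+ 2.
Proof.
by rewrite (le_trans (rdot_bop_le _ _))// ler_wpM2r ?sqr_ge0// op_cos_norm.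
Qed.

Lemma op_cos_near1 t : `|t| <= 1 -> `|op_cos t - 1| <= expR `|Y| * t ^+ 2.
Proof.
move=> t1; have t1' : `|- t| <= 1 by rewrite normrN.
have := exp_bop_taylor1 Y t1; have := exp_bop_taylor1 Y t1'.
rewrite sqrrN; set a := exp_bop _ - 1 - _; set b := exp_bop _ - 1 - _ => ha hb.
have -> : op_cos t - 1 = half *: (a + b).
  rewrite -{1}op_cos0 /op_cos oppr0 scale0r exp_bop0 -scalerBr; congr (_ *: _).
  rewrite [RHS]addrC /a /b scaleNr.
  by rewrite opprK [RHS]addrACA addNr addr0 [RHS]addrACA opprD.
rewrite normrZ ger0_norm// ler_pdivrMl// (le_trans (ler_normD _ _))//.
by move: ha hb; move: (expR _ * _) => c; lra.
Qed.

Lemma op_cos_cts : continuous op_cos.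
Proof.
move=> t; apply: cvgZr; apply: cvgD; first exact: exp_bop_cts.
apply: (continuous_comp (g := fun s => exp_bop (s *: Y))).
  exact: oppr_continuous.
exact: exp_bop_cts.
Qed.

(* With [S] a square root of [G] commuting with [A], [A G = S A S]. *)
Lemma coercive_quotient A G : is_adjoint A A -> is_adjoint G G ->
  A * G = G * A -> coercive G -> coercive (A * G) -> coercive A.
Proof.
move=> sA sG AG cG [d d0 AGd].
have [S [sS _ SS cS]] := psqrt_exists sG (coercive_pos cG).
have [B [GB BG]] := coercive_inv sG cG.
have AS : A * S = S * A by exact: cS.
pose M := `|S| ^+ 2 + 1; have M0 : 0 < M by rewrite ltr_wpDl ?sqr_ge0.
exists (d / M) => [|y]; first by rewrite divr_gt0.
(* [S] is onto because [G = S S] is invertible, so the form of [A] at [y = S x] is that of [A G] at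
   [x]. *)
pose x := S (B y); have yx : y = S x by rewrite /x -!bopM SS GB.
rewrite mulrAC ler_pdivrMr// (@le_trans _ _ (d * (M * hnorm x ^+ 2)))//.
  rewrite ler_pM2l// yx (@le_trans _ _ ((`|S| * hnorm x) ^+ 2))//.
    by rewrite ler_pXn2r ?nnegrE ?mulr_ge0 ?hnorm_ge0// hnorm_bop.
  by rewrite exprMn ler_wpM2r ?sqr_ge0// lerDl.
rewrite mulrCA mulrC ler_pM2r// (le_trans (AGd x))//.
rewrite -SS mulrA AS -mulrA bopM; have /is_adjointP -> := sS.
by rewrite bopM -yx.
Qed.

(** [0 <= C(t) <= 1] gives [C(t) >= C(t)^2 = (C(2 t) + 1) / 2 >= 1 / 2]. *)
Lemma op_cos_half_coercive t : pos (op_cos t) -> pos (op_cos (2 * t)) ->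
  coercive (op_cos t).
Proof.
move=> pt p2; exists half => // x.
have := form_bound_norm ler01 (op_cos_adj t) pt (op_cos_le t) x.
rewrite mul1r; apply: le_trans; rewrite (adj_norm (op_cos_adj t)) -bopM.
have E : 2 *: (op_cos t * op_cos t) = op_cos (2 * t) + 1.
  by rewrite op_cosM subrr op_cos0; congr (op_cos _ + _); ring.
have := p2 x.
have : 2 * rdot ((op_cos t * op_cos t) x) x = rdot (op_cos (2 * t) x) x + hnorm x ^+ 2.
  by rewrite -rdotZl -bopZ E bopD rdotDl bop1 rdotxx.
lra.
Qed.

(* For [tau < t < 2 tau], the identity
   [2 C(t) C(2 tau - t) = C(2 tau) + C(2 (t - tau))] reduces coercivity at [t] to
   coercivity at [2 (t - tau)], whose distance to [2 tau] is twice as large. *)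
Lemma op_cos_double (tau : R) : 0 < tau ->
  (forall t, 0 <= t <= tau -> coercive (op_cos t)) -> pos (op_cos (2 * tau)) ->
  forall t, 0 <= t < 2 * tau -> coercive (op_cos t).
Proof.
move=> tau0 ctau p2 t /andP[t0 t2].
(* Stage [m] stops [tau / 2^m] short of [2 tau]; any [t < 2 tau] is reached by some stage, and the
   coercivity constant may depend on it. *)
suff h m : forall r, 0 <= r <= 2 * tau - tau * half ^+ m -> coercive (op_cos r).
  have e0 : 0 < (2 * tau - t) / tau by rewrite divr_gt0// subr_gt0.
  have h0 : (fun m => half ^+ m) @ \oo --> (0 : R).
    by apply: cvg_expr; rewrite ger0_norm//; lra.
  have [m _ /(_ m (leqnn m))] : \forall m \near \oo, `|half ^+ m| < (2 * tau - t) / tau.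
    exact: cvgr0_norm_lt h0 _ e0.
  rewrite /= ger0_norm ?exprn_ge0// ltr_pdivlMr// => hm.
  by apply: (h m); rewrite t0/=; move: hm; rewrite mulrC; lra.
elim: m => [r|m IH r /andP[r0 rm]].
  by rewrite expr0 mulr1 => rt; apply: ctau; move: rt; lra.
have [rt|rt] := leP r tau; first by apply: ctau; rewrite r0.
have hm0 : 0 < half ^+ m by rewrite exprn_gt0.
have r2 : r < 2 * tau.
  by rewrite (le_lt_trans rm)// gtrBl mulr_gt0// exprn_gt0.
have cs : coercive (op_cos (2 * tau - r)) by apply: ctau; lra.
apply: (coercive_quotient (op_cos_adj r) (op_cos_adj (2 * tau - r))) => //.
  exact: op_cos_comm.
have [|d d0 cd] := IH (2 * (r - tau)).
  by move: rm; rewrite exprS; lra.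
exists (d / 2); first by rewrite divr_gt0.
move=> x; have := op_cosM r (2 * tau - r).
have -> : r + (2 * tau - r) = 2 * tau by ring.
have -> : r - (2 * tau - r) = 2 * (r - tau) by ring.
move=> E; have := p2 x; have := cd x.
have : 2 * rdot ((op_cos r * op_cos (2 * tau - r)) x) x =
    rdot (op_cos (2 * tau) x) x + rdot (op_cos (2 * (r - tau)) x) x.
  by rewrite -rdotZl -bopZ E bopD rdotDl.
lra.
Qed.

Lemma op_cos_coercive : (forall n, pos (op_cos (half ^+ n))) ->
  forall t, 0 <= t < 1 -> coercive (op_cos t).
Proof.
move=> pn.
(* [N] is such that [expR |Y| * 2^-N < 1 / 2], which keeps [C(t)] within [1 / 2] of the identity on
   [[0, 2^-N]]; [N] doublings then reach 1. *)
have [N base] : exists N, forall t, 0 <= t <= half ^+ N -> coercive (op_cos t).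
  pose K := expR `|Y|; have K0 : 0 < K by exact: expR_gt0.
  have h0 : (fun m => half ^+ m) @ \oo --> (0 : R).
    by apply: cvg_expr; rewrite ger0_norm//; lra.
  have e0 : 0 < half / K by rewrite divr_gt0.
  have [N _ /(_ N (leqnn N))] : \forall m \near \oo, `|half ^+ m| < half / K.
    exact: cvgr0_norm_lt h0 _ e0.
  rewrite /= ger0_norm ?exprn_ge0// ltr_pdivlMr// => hN; exists N => t /andP[t0 tN].
  have N1 : half ^+ N <= 1 by rewrite exprn_ile1//; lra.
  have t1 : `|t| <= 1 by rewrite ger0_norm// (le_trans tN).
  exists half => // x.
  have -> : op_cos t = 1 - (1 - op_cos t) by rewrite opprB addrC subrK.
  rewrite bopB bop1 rdotBl rdotxx.
  have : rdot ((1 - op_cos t) x) x <= half * hnorm x ^+ 2.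
    rewrite (le_trans (rdot_bop_le _ _))// ler_wpM2r ?sqr_ge0// distrC.
    rewrite (le_trans (op_cos_near1 t1))// -/K (le_trans _ (ltW hN))// mulrC.
    by rewrite ler_pM2r// (le_trans _ tN)// expr2 ler_piMl// -(ger0_norm t0).
  lra.
suff h k : (k <= N)%N -> forall t, 0 <= t < half ^+ (N - k) -> coercive (op_cos t).
  by move=> t; have := h N (leqnn N); rewrite subnn expr0; exact.
elim: k => [_ t|k IH kN t].
  by rewrite subn0 => /andP[t0 /ltW tN]; apply: base; rewrite t0.
have NkE : half ^+ (N - k.+1) = 2 * half ^+ (N - k).
  by rewrite -(subnSK kN) exprS mulrA mulfV// mul1r.
rewrite NkE; apply: op_cos_double; first by rewrite exprn_gt0.
  (* The induction hypothesis excludes the endpoint [2^-(N-k)]; there positivity at the point and at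
     its double gives coercivity. *)
  move=> r /andP[r0]; rewrite le_eqVlt => /predU1P[->|rk].
    apply: op_cos_half_coercive; first exact: pn.
    by rewrite -NkE; exact: pn.
  by apply: (IH (ltnW kN)); rewrite r0.
by rewrite -NkE; exact: pn.
Qed.

End operator_cosine.

(** * Generators of geodesics between symmetries *)

Section projections_and_symmetries.
Context {R : realType} {H : hilbertType R}.
Implicit Types (P Q e Y E : bop H).
Local Notation half := (2^-1 : R).

Lemma symmetry_conj P E F : E * F = 1 ->
  symmetry_of (E * P * F) = E * symmetry_of P * F.
Proof.
by move=> EF; rewrite mulrBr mulrBl mulr1 EF -bop_scalerAr -bop_scalerAl.
Qed.

Lemma symmetry_inj P Q : symmetry_of P = symmetry_of Q -> P = Q.
Proof.
by move=> /addIr/(congr1 (fun A => half *: A)); rewrite !scalerA mulVf// !scale1r.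
Qed.

Lemma injective_op1D E F : is_adjoint E F -> pos (E + F) -> injective_op (E + 1).
Proof.
move=> /is_adjointP aE pE x h; apply: rdotxx_eq0.
have : rdot ((E + 1) x) x = 0 by rewrite h rdot0l.
have := pE x; rewrite !bopD !rdotDl bop1 [rdot (F x) x]rdotC -aE.
by have := rdotxx_ge0 x; lra.
Qed.

Lemma exp_slope_cvg Y :
  (fun n => 2 ^+ n *: (exp_bop (half ^+ n *: Y) - 1)) @ \oo --> Y.
Proof.
have hk k : 2 ^+ k * (half ^+ k) = 1 by rewrite -exprMn mulfV// expr1n.
have h0 : (fun n => expR `|Y| * half ^+ n) @ \oo --> (0 : R).
  rewrite -(mulr0 (expR `|Y|)); apply: cvgM; first exact: cvg_cst.
  by apply: cvg_expr; rewrite ger0_norm//; lra.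
apply/subr_cvg0/norm_cvg0P.
apply: (@squeeze_cvgr _ _ _ _ (fun=> 0) (fun n => expR `|Y| * half ^+ n)) => //.
  near=> n; rewrite normr_ge0/=.
  have h1 : `|half ^+ n| <= 1 by rewrite ger0_norm ?exprn_ge0// exprn_ile1//; lra.
  have -> : 2 ^+ n *: (exp_bop (half ^+ n *: Y) - 1) - Y =
      2 ^+ n *: (exp_bop (half ^+ n *: Y) - 1 - half ^+ n *: Y).
    by rewrite [in RHS]scalerBr scalerA hk scale1r.
  rewrite normrZ ger0_norm ?exprn_ge0//.
  rewrite (le_trans (ler_wpM2l _ (exp_bop_taylor1 Y h1))) ?exprn_ge0//.
  by rewrite mulrCA expr2 [2 ^+ n * _]mulrA hk mul1r.
exact: cvg_cst.
Unshelve. all: by end_near. Qed.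

Section geodesics_from_a_symmetry.
Context (e0 : bop H) (e0_adj : is_adjoint e0 e0) (e0_sqr : e0 * e0 = 1).

(* The half-angle symmetries [e_n] between [e0] and [e1] give the dyadic roots
   [e_n * e0] of the unitary joining [e0] to its midpoint with [e1]. *)
Lemma geodesic_generator_exists e1 :
  is_adjoint e1 e1 -> e1 * e1 = 1 -> injective_op (e0 + e1) ->
  exists Y, [/\ is_adjoint Y (- Y), e0 * Y * e0 = - Y,
    exp_bop (1 *: Y) * e0 * exp_bop (- 1 *: Y) = e1 &
    forall n, pos (op_cos Y (half ^+ n))].
Proof.
move=> s1 i1 iA.
pose good e := [/\ is_adjoint e e, e * e = 1 & injective_op (e0 + e)].
(* The midpoint can be bisected again: [(e0 + f)^2 = 2 + (f e0 + e0 f) >= 2], so [e0 + f] is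
   injective. *)
have good_mid e : good e -> exists f,
    [/\ good f, f * e0 * f = e & pos (f * e0 + e0 * f)].
  case=> se ie inj; have [f [sf if_ fe pf]] := midpoint_exists e0_adj e0_sqr se ie inj.
  exists f; split=> //; split=> // x fx; apply: rdotxx_eq0.
  have : rdot (((e0 + f) * (e0 + f)) x) x = 0 by rewrite bopM fx linear0 rdot0l.
  have -> : (e0 + f) * (e0 + f) = (1 + 1) + (f * e0 + e0 * f).
    by rewrite mulrDl !mulrDr e0_sqr if_ [f * e0 + 1]addrC addrACA [e0 * f + _]addrC.
  rewrite bopD rdotDl bopD rdotDl bop1 => h.
  by have := pf x; have := rdotxx_ge0 x; move: h; lra.
have /choice[f fP] : forall e, exists f, good e ->
    [/\ good f, f * e0 * f = e & pos (f * e0 + e0 * f)].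
  by move=> e; have [/good_mid[f ?]|nge] := pselect (good e); [exists f|exists 0].
pose m n := iter n f e1.
have mgood n : good (m n) by elim: n => // n /fP[].
have mP n : [/\ m n.+1 * e0 * m n.+1 = m n & pos (m n.+1 * e0 + e0 * m n.+1)].
  by have [] := fP _ (mgood n).
(* The shift in the index makes [u 0] join [e0] to its midpoint with [e1 = m 0], so that [u 0]
   squares to [e1 * e0]. *)
pose u n := m n.+1 * e0; pose us n := e0 * m n.+1.
have u_adj n : is_adjoint (u n) (us n) by apply: adjM => //; case: (mgood n.+1).
have u_us n : u n * us n = 1.
  by have [_ ? _] := mgood n.+1; rewrite /u /us mulrA -[_ * e0 * e0]mulrA e0_sqr mulr1.
have us_u n : us n * u n = 1.
  by have [_ mm _] := mgood n.+1; rewrite /u /us mulrA -[_ * _ * m _]mulrA mm mulr1.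
have u_root n : u n.+1 * u n.+1 = u n.
  by rewrite /u mulrA; have [-> _] := mP n.+1.
have u_pos n : pos (u n + us n) by case: (mP n).
have [Y [aY YP Yu]] := dyadic_log u_adj u_us us_u u_root u_pos.
have Yus n : exp_bop (- half ^+ n *: Y) = us n.
  apply: (adj_uniq (exp_unitary _ aY)).
  by rewrite Yu; exact: u_adj.
exists Y; split=> //.
(* Conjugation by [e0] turns the slopes of [u] into those of [us], so [e0 * Y * e0] is an adjoint of
   [Y], as is [- Y]. *)
- apply: (@adj_uniq _ _ Y) => //.
  have c : (fun n => e0 * root_slope u n * e0) @ \oo --> e0 * Y * e0.
    by apply: bop_cvgM; [apply: bop_cvgM; [exact: cvg_cst|exact: YP]|exact: cvg_cst].
  apply: (is_adjoint_lim _ YP c) => n.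
  rewrite /root_slope -bop_scalerAr -bop_scalerAl; apply: adjZ.
  rewrite mulrBr mulrBl mulr1 e0_sqr /u.
  have -> : e0 * (m n.+1 * e0) * e0 = us n by rewrite -!mulrA e0_sqr mulr1.
  exact: (adjB (u_adj n) (@adj1 _ _)).
- have := Yu 0; have := Yus 0; rewrite !expr0 => -> ->; rewrite /u /us.
  have [mm _] := mP 0%N; rewrite -[RHS]/(m 0%N) -mm !mulrA.
  by rewrite -[_ * e0 * e0]mulrA e0_sqr mulr1.
- by move=> n; rewrite /op_cos Yu Yus; apply: posZ.
Qed.

Lemma exp_conj_symmetry Y t : e0 * Y * e0 = - Y ->
  e0 * exp_bop (t *: Y) = exp_bop (- t *: Y) * e0.
Proof.
move=> eY; apply: exp_bop_intertwine.
rewrite -bop_scalerAr scaleNr -scalerN -bop_scalerAl -eY.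
by rewrite -[_ * Y * e0 * e0]mulrA e0_sqr mulr1.
Qed.

(** Injectivity of [e0 + e1] identifies the first root through [e1 e0 + 1 = (e0 + e1) e0]. For later
    roots the square is the previous root [E], and [E + 1] is injective because [E] has nonnegative
    real part. *)
Lemma geodesic_generator_uniq e1 Y Z : injective_op (e0 + e1) ->
  is_adjoint Y (- Y) -> e0 * Y * e0 = - Y ->
  exp_bop (1 *: Y) * e0 * exp_bop (- 1 *: Y) = e1 ->
  (forall n, pos (op_cos Y (half ^+ n))) ->
  is_adjoint Z (- Z) -> e0 * Z * e0 = - Z ->
  exp_bop (1 *: Z) * e0 * exp_bop (- 1 *: Z) = e1 ->
  (forall n, pos (op_cos Z (half ^+ n))) -> Y = Z.
Proof.
move=> iA aY eY Y1 pY aZ eZ Z1 pZ.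
have sq (X : bop H) : e0 * X * e0 = - X -> exp_bop (1 *: X) * e0 * exp_bop (- 1 *: X) = e1 ->
    exp_bop (1 *: X) * exp_bop (1 *: X) = e1 * e0.
  move=> eX <-; rewrite -!mulrA -exp_conj_symmetry ?opprK// !mulrA.
  by rewrite -[_ * e0 * e0]mulrA e0_sqr mulr1.
have exppos (X : bop H) (s : R) : pos (op_cos X s) -> pos (exp_bop (s *: X) + exp_bop (- s *: X)).
  by move=> pX x; have := pX x; rewrite /op_cos bopZ rdotZl pmulr_rge0.
have same n : exp_bop (half ^+ n *: Y) = exp_bop (half ^+ n *: Z).
  elim: n => [|n IH].
    rewrite expr0; apply: (unitary_root_uniq (exp_unitary _ aY) (exp_bopMN _ _)
      (exp_bopNM _ _) _ (exp_unitary _ aZ) (exp_bopMN _ _) (exp_bopNM _ _)).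
    - by apply: exppos; exact: (pY 0%N).
    - by apply: exppos; exact: (pZ 0%N).
    - by rewrite !sq.
    - move=> x; rewrite sq// => h.
      suff: e0 x = 0 by move=> /(congr1 e0); rewrite -bopM e0_sqr linear0.
      by apply: iA; rewrite -bopM mulrDl e0_sqr addrC.
  have hn : half ^+ n = half ^+ n.+1 + half ^+ n.+1.
    by rewrite (exprS half); move: (half ^+ n) => a; lra.
  have dbl (X : bop H) : exp_bop (half ^+ n.+1 *: X) * exp_bop (half ^+ n.+1 *: X) =
      exp_bop (half ^+ n *: X).
    by rewrite -exp_bopD -hn.
  apply: (unitary_root_uniq (exp_unitary _ aY) (exp_bopMN _ _)
    (exp_bopNM _ _) _ (exp_unitary _ aZ) (exp_bopMN _ _) (exp_bopNM _ _)).
  - by apply: exppos; exact: pY.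
  - by apply: exppos; exact: pZ.
  - by rewrite !dbl.
  - by rewrite dbl; apply: (injective_op1D (exp_unitary _ aY)); exact: exppos.
have cY := @exp_slope_cvg Y; have cZ := @exp_slope_cvg Z.
apply: (cvg_unique _ cY) => //.
by rewrite (_ : (fun n => _) = fun n => 2 ^+ n *: (exp_bop (half ^+ n *: Z) - 1))//;
  apply/funext => n; rewrite same.
Qed.

End geodesics_from_a_symmetry.
End projections_and_symmetries.

(** * Great circles and graphs *)

Section blocks.
Context {R : realType} {H : hilbertType R}.
Local Notation K := (hsum H H).
Implicit Types (A B G Y : bop K) (z w : K) (h k : H) (t s : R).
Local Notation half := (2^-1 : R).

Definition emb1 h : K := (h, 0).

Lemma rdot_hsum z w : rdot z w = rdot z.1 w.1 + rdot z.2 w.2.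
Proof.
rewrite /rdot -[inner z w]/(inner z.1 w.1 + inner z.2 w.2).
by case: (inner z.1 w.1) (inner z.2 w.2) => a b [].
Qed.

Lemma hnorm_hsum z : hnorm z ^+ 2 = hnorm z.1 ^+ 2 + hnorm z.2 ^+ 2.
Proof. by rewrite -!rdotxx rdot_hsum. Qed.

Lemma hnorm_emb1 h : hnorm (emb1 h) = hnorm h.
Proof.
apply/eqP; rewrite -(@eqrXn2 _ 2) ?hnorm_ge0// hnorm_hsum/= hnorm0.
by rewrite expr0n addr0.
Qed.

Lemma hnorm_snd z : hnorm z.2 <= hnorm z.
Proof.
rewrite -(@ler_pXn2r _ 2) ?nnegrE ?hnorm_ge0// [leRHS]hnorm_hsum.
by rewrite lerDr sqr_ge0.
Qed.

Lemma emb1_linear (a : R[i]) h k : emb1 (a *: h + k) = a *: emb1 h + emb1 k.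
Proof. by congr pair; rewrite /= scaler0 addr0. Qed.

Lemma p0E z : p0 z = emb1 z.1. Proof. by []. Qed.

Lemma p0_emb1 h : p0 (emb1 h) = emb1 h. Proof. by []. Qed.

Lemma p0_adj : is_adjoint (@p0 R H) p0.
Proof.
apply/is_adjointP => z w; rewrite !rdot_hsum/= rdot0l rdot0r.
by [].
Qed.

Lemma p0_sqr : p0 * p0 = p0 :> bop K. Proof. exact/bop_ext. Qed.

Definition eps0 : bop K := symmetry_of p0.

Lemma p0_eps0 : p0 = half *: (eps0 + 1).
Proof. by rewrite /eps0 /symmetry_of subrK scalerA mulVf// scale1r. Qed.

Lemma eps0_sqr : eps0 * eps0 = 1. Proof. exact: symmetry_sqr p0_sqr. Qed.

Lemma eps0_adj : is_adjoint eps0 eps0. Proof. exact: symmetry_adj p0_adj. Qed.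

Lemma p0_comm A : eps0 * A = A * eps0 -> p0 * A = A * p0.
Proof.
by move=> eA; rewrite p0_eps0 -bop_scalerAl -bop_scalerAr mulrDl mulrDr eA mul1r mulr1.
Qed.

Lemma halfD A : half *: (A + A) = A.
Proof.
have -> : A + A = (2 : R) *: A by rewrite scaler_nat mulr2n.
by rewrite scalerA mulVf// scale1r.
Qed.

Lemma p0_anticomm A : eps0 * A = - (A * eps0) -> p0 * A = A * (1 - p0).
Proof.
move=> eA; rewrite p0_eps0 mulrBr mulr1 -bop_scalerAl -bop_scalerAr.
rewrite mulrDl mulrDr eA mul1r mulr1 -[X in X - _]halfD.
by rewrite -scalerBr addrC [A * eps0 + _]addrC addrKA.
Qed.

Lemma compress_linear A : linear (fun h => (A (emb1 h)).2).
Proof. by move=> a h k; rewrite emb1_linear bop_linear. Qed.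

Lemma compress_bound A h : hnorm ((A (emb1 h)).2) <= `|A| * hnorm h.
Proof. by rewrite (le_trans (hnorm_snd _))// -(hnorm_emb1 h) hnorm_bop. Qed.

(** The lower left entry of the block matrix of [A]. *)
Definition compress A : bop H :=
  BOp (compress_linear A) (ex_intro _ _ (compress_bound A)).

Lemma compressB A B : compress A - compress B = compress (A - B).
Proof. by apply/bop_ext => h; rewrite bopB [RHS](_ : _ = ((A - B) (emb1 h)).2)// bopB. Qed.

Lemma compress_norm A : `|compress A| <= `|A|.
Proof. by apply: bop_norm_le => // h; exact: compress_bound. Qed.

Lemma compress0 : compress 0 = 0. Proof. exact/bop_ext. Qed.

Section rotation.
Context (Y : bop K) (Y_skew : is_adjoint Y (- Y)) (eps0Y : eps0 * Y * eps0 = - Y).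

(** The skew-adjoint part of [exp (t Y)]. Since [eps0] anticommutes with [Y], the sine is block
    off-diagonal and the cosine block diagonal. *)
Definition op_sin t : bop K := half *: (exp_bop (t *: Y) - exp_bop (- t *: Y)).

Lemma exp_cos_sin t : exp_bop (t *: Y) = op_cos Y t + op_sin t.
Proof.
rewrite /op_cos /op_sin -scalerDr addrACA subrr addr0.
by rewrite halfD.
Qed.

Lemma eps0_exp t : eps0 * exp_bop (t *: Y) = exp_bop (- t *: Y) * eps0.
Proof. exact: (exp_conj_symmetry eps0_sqr). Qed.

Lemma eps0_expN t : eps0 * exp_bop (- t *: Y) = exp_bop (t *: Y) * eps0.
Proof. by rewrite eps0_exp opprK. Qed.

Lemma p0_cos t : p0 * op_cos Y t = op_cos Y t * p0.
Proof.
apply: p0_comm; rewrite /op_cos -bop_scalerAl -bop_scalerAr [in LHS]mulrDr [in RHS]mulrDl.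
by rewrite eps0_exp eps0_expN addrC.
Qed.

Lemma p0_sin t : p0 * op_sin t = op_sin t * (1 - p0).
Proof.
apply: p0_anticomm; rewrite /op_sin -bop_scalerAl -bop_scalerAr [in LHS]mulrBr [in RHS]mulrBl.
by rewrite eps0_exp eps0_expN -scalerN opprB.
Qed.

Definition great_circle t : bop K :=
  exp_bop (t *: Y) * p0 * exp_bop (- t *: Y).

Lemma great_circle_sqr t : great_circle t * great_circle t = great_circle t.
Proof.
rewrite /great_circle !mulrA -[_ * exp_bop (- t *: Y) * exp_bop _]mulrA exp_bopNM.
by rewrite mulr1 -[_ * p0 * p0]mulrA p0_sqr.
Qed.

Lemma great_circle_adj t : is_adjoint (great_circle t) (great_circle t).
Proof.
rewrite [X in is_adjoint _ X](_ : _ = exp_bop (t *: Y) * (p0 * exp_bop (- t *: Y))).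
  apply: adjM; last by have := exp_unitary (- t) Y_skew; rewrite opprK.
  by apply: adjM p0_adj; exact: exp_unitary.
by rewrite mulrA.
Qed.

Lemma great_circle_range t :
  range (great_circle t) = [set exp_bop (t *: Y) (emb1 h) | h in setT].
Proof.
apply/seteqP; split=> [_ [z _ <-]|_ [h _ <-]].
  by exists (exp_bop (- t *: Y) z).1.
exists (exp_bop (t *: Y) (emb1 h)) => //.
by rewrite -bopM /great_circle -mulrA exp_bopNM mulr1.
Qed.

(** Meant for [G] inverse to [op_cos Y t]: a block of sine over cosine. *)
Definition tangent_op t G : bop H := compress (op_sin t * G).

Lemma sin_emb1 t h : (op_sin t (emb1 h)).1 = 0.
Proof.
have := congr1 (fun A : bop K => (A (emb1 h)).1) (p0_sin t).
by rewrite !bopM bopB bop1 p0_emb1 subrr linear0.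
Qed.

Lemma comm_emb1 A h : p0 * A = A * p0 -> A (emb1 h) = emb1 (A (emb1 h)).1.
Proof.
by move=> pA; rewrite -[in LHS]p0_emb1 -bopM -pA.
Qed.

Lemma exp_emb1 t h : exp_bop (t *: Y) (emb1 h) =
  ((op_cos Y t (emb1 h)).1, (op_sin t (emb1 h)).2).
Proof.
rewrite exp_cos_sin bopD; rewrite (comm_emb1 _ (p0_cos t)).
move: (op_cos Y t (emb1 h)).1 (op_sin t (emb1 h)) (sin_emb1 t h) => k [l m] /= ->.
by congr pair; rewrite /= ?addr0 ?add0r.
Qed.

(** The range consists of the pairs [(C h, S h)]. The inverse [G] of the cosine also preserves the
    first summand, so [k = C h] runs over all of [H] and the pairs are [(k, S G k)]. *)
Lemma graph_tangent_op t G : op_cos Y t * G = 1 -> G * op_cos Y t = 1 ->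
  graph (tangent_op t G) = range (great_circle t).
Proof.
move=> CG GC; rewrite great_circle_range.
have pG : p0 * G = G * p0.
  rewrite -[LHS]mul1r -GC -!mulrA [op_cos _ _ * _]mulrA -p0_cos -!mulrA CG mulr1.
  by [].
have key h : ((op_cos Y t (emb1 h)).1, tangent_op t G (op_cos Y t (emb1 h)).1) =
    exp_bop (t *: Y) (emb1 h) :> K.
  rewrite exp_emb1; congr pair.
  have -> : tangent_op t G (op_cos Y t (emb1 h)).1 =
      ((op_sin t * G) (emb1 (op_cos Y t (emb1 h)).1)).2 by [].
  by rewrite -(comm_emb1 _ (p0_cos t)) -bopM -mulrA GC mulr1.
apply/seteqP; split=> [_ [k _ <-]|_ [h _ <-]].
  exists (G (emb1 k)).1 => //; rewrite -key -(comm_emb1 _ pG) -bopM CG.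
  by [].
by exists (op_cos Y t (emb1 h)).1; [|exact: key].
Qed.

Lemma great_circle_orthoproj t G : op_cos Y t * G = 1 -> G * op_cos Y t = 1 ->
  is_orthoproj (graph (tangent_op t G)) (great_circle t).
Proof.
move=> CG GC; split; [exact: great_circle_sqr|exact: great_circle_adj|].
by rewrite graph_tangent_op.
Qed.

Lemma op_sin_cts : continuous op_sin.
Proof.
move=> t; apply: cvgZr; apply: cvgB; first exact: exp_bop_cts.
apply: (continuous_comp (g := fun s => exp_bop (s *: Y))).
  exact: oppr_continuous.
exact: exp_bop_cts.
Qed.

Lemma op_sin0 : op_sin 0 = 0.
Proof. by rewrite /op_sin oppr0 subrr scaler0. Qed.

End rotation.
End blocks.

Section projection_on_graph.
Context {R : realType} {H : hilbertType R}.
Implicit Types (T : operator H) (A B : bop H).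

Lemma proj_graphE T P : is_orthoproj (graph T) P -> proj_graph T = P.
Proof. by move=> PT; exact: (orthoproj_uniq (getPex (ex_intro _ P PT)) PT). Qed.

Lemma graph0 T : graph T 0.
Proof.
exists 0; first exact: dom0.
have := op_linear (-1) (dom0 T) (dom0 T).
by rewrite scaler0 addr0 scaleN1r addNr => ->.
Qed.

Lemma graph_linear T a z w : graph T z -> graph T w -> graph T (a *: z + w).
Proof.
move=> [h dh <-] [k dk <-]; exists (a *: h + k); first exact: dom_linear.
by rewrite op_linear.
Qed.

Lemma proj_graphP T : closed (graph T) -> is_orthoproj (graph T) (proj_graph T).
Proof.
move=> clT; have [P PT] := orthoproj_exists (@graph0 T) (@graph_linear T) clT.
by rewrite (proj_graphE PT).
Qed.

Lemma closed_graph_bop A : closed (graph A).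
Proof.
(* The graph is the kernel of [z |-> (0, A z.1 - z.2)], padded by 0 so as to be an endomorphism to
   which [closed_kernel] applies. *)
have bd (z : hsum H H) : hnorm ((0, A z.1 - z.2) : hsum H H) <= (`|A| + 1) * hnorm z.
  rewrite -(@ler_pXn2r _ 2) ?nnegrE ?mulr_ge0 ?hnorm_ge0 ?addr_ge0//.
  rewrite hnorm_hsum/= hnorm0 expr0n add0r.
  rewrite ler_pXn2r ?nnegrE ?mulr_ge0 ?hnorm_ge0 ?addr_ge0//.
  rewrite (le_trans (hnormD _ _))// hnormN mulrDl mul1r lerD ?hnorm_snd//.
  rewrite (le_trans (hnorm_bop _ _))// ler_wpM2l//.
  rewrite -(@ler_pXn2r _ 2) ?nnegrE ?hnorm_ge0// [leRHS]hnorm_hsum.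
  by rewrite lerDl sqr_ge0.
have lin : linear (fun z : hsum H H => (0, A z.1 - z.2) : hsum H H).
  move=> a z w; congr pair; rewrite /= ?scaler0 ?addr0//.
  by rewrite bop_linear scalerBr opprD addrACA.
have -> : graph A = [set z | BOp lin (ex_intro _ _ bd) z = 0].
  apply/seteqP; split=> [_ [h _ <-]|[h k] /= [/eqP]].
    by rewrite /= subrr.
  by rewrite subr_eq0 => /eqP <-; exists h.
exact: closed_kernel.
Qed.

Lemma graph_bop_inj A B : graph A = graph B -> A = B.
Proof.
move=> AB; apply/bop_ext => h.
have [k _ [-> //]] : graph B ((h, A h) : hsum H H) by rewrite -AB; exists h.
Qed.

Lemma proj_graph_inj A B : proj_graph A = proj_graph B -> A = B.
Proof.
move=> AB; apply: graph_bop_inj.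
have [_ _ <-] := proj_graphP (@closed_graph_bop A).
by have [_ _ <-] := proj_graphP (@closed_graph_bop B); rewrite AB.
Qed.

Lemma proj_graph0 : proj_graph (0 : bop H) = p0.
Proof.
apply: proj_graphE; split; [exact: p0_sqr|exact: p0_adj|].
by apply/seteqP; split=> [_ [z _ <-]|_ [h _ <-]]; [exists z.1|exists ((h, 0) : hsum H H)].
Qed.

End projection_on_graph.

(** * Lengths of great circles *)

(** With [a = h Y] and Taylor remainders [r], [s], every term on the right is of second order in
    [h]. *)
Lemma conj_expand (B : pzRingType) (a q r s : B) :
  (1 + a + r) * q * (1 - a + s) - q - (a * q - q * a) =
  (1 + a + r) * q * s + r * q * (1 - a) - a * q * a.
Proof.
set X := (1 + a + r) * q; rewrite mulrDr.
have -> : X * (1 - a) = q + (a * q - q * a) - a * q * a + r * q * (1 - a).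
  rewrite /X 3!mulrDl mul1r; congr (_ + _).
  by rewrite mulrBr mulr1 mulrDl opprD addrA -(addrA q).
set d := a * q - q * a; set M := r * q * _; set L := X * s; set z := a * q * a.
by rewrite -addrA -opprD addrC -!(addrA (q + d)) addKr addrC [- z + M]addrC addrA.
Qed.

Section finsler_length.
Context {R : realType} {H : hilbertType R}.
Local Notation K := (hsum H H).

Lemma is_derive_quadratic (V : normedModType R) (f : R -> V) (t C : R) (d : V) :
  (forall h, `|h| <= 1 -> `|f (t + h) - f t - h *: d| <= C * h ^+ 2) ->
  is_derive t (1 : R) f d.
Proof.
move=> fd.
have lim : (fun h => h^-1 *: ((f \o shift t) (h *: (1 : R)) - f t)) @ 0^' --> d.
  apply/subr_cvg0/norm_cvg0P.
  apply: (@squeeze_cvgr _ _ _ _ (fun=> 0) (fun h => C * `|h|)).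
  - near=> h; rewrite normr_ge0/=.
    have hN0 : h != 0 by near: h; exact: nbhs_dnbhs_neq.
    have h1 : `|h| <= 1.
      near: h; apply: nbhs_dnbhs.
      have := @nbhs0_le R R 1 ltr01.
      by apply: filterS => h.
    have -> : h^-1 *: (f (h *: (1 : R) + t) - f t) - d =
        h^-1 *: (f (t + h) - f t - h *: d).
      rewrite [in RHS]scalerBr scalerA mulVf// scale1r [h *: 1]mulr1.
      by rewrite [h + t]addrC.
    rewrite normrZ normfV ler_pdivrMl ?normr_gt0// mulrCA -expr2 real_normK ?num_real//.
    exact: fd.
  - exact: cvg_cst.
  - have h1 : (fun h : R => `|h|) @ 0^' --> `|0 : R|.
      apply: cvg_within_filter; apply: cvg_norm.
      by move=> B.
    have h2 : (fun h : R => C * `|h|) @ 0^' --> C * `|0 : R|.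
      by apply: cvgM; [exact: cvg_cst|exact: h1].
    by rewrite normr0 mulr0 in h2.
apply: DeriveDef; first exact: cvgP lim.
by rewrite /derive; apply/cvg_lim.
Unshelve. all: by end_near. Qed.

Implicit Types (Y q : bop K) (t s : R).

Definition conj_curve Y q t : bop K := exp_bop (t *: Y) * q * exp_bop (- t *: Y).

Lemma conj_curveD Y q s t : conj_curve Y q (s + t) = conj_curve Y (conj_curve Y q s) t.
Proof.
by rewrite /conj_curve addrC exp_bopD opprD addrC exp_bopD !mulrA.
Qed.

(** An estimate at time 0 is enough: [conj_curveD] moves it to time [t] by replacing [q] with
    [conj_curve Y q t]. *)
Lemma conj_curve_taylor Y q h : is_adjoint Y (- Y) -> `|h| <= 1 ->
  `|conj_curve Y q h - q - h *: (Y * q - q * Y)| <=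
  (expR `|Y| * `|q| * (2 + `|Y|) + `|Y| ^+ 2 * `|q|) * h ^+ 2.
Proof.
move=> aY h1; pose r := exp_bop (h *: Y) - 1 - h *: Y.
pose r' := exp_bop (- h *: Y) - 1 - - h *: Y.
have rK : `|r| <= expR `|Y| * h ^+ 2 by exact: exp_bop_taylor1.
have rK' : `|r'| <= expR `|Y| * h ^+ 2.
  by rewrite -[h ^+ 2]sqrrN; apply: exp_bop_taylor1; rewrite normrN.
have E1 : exp_bop (h *: Y) = 1 + h *: Y + r by rewrite /r addrC [1 + _]addrC addrA !subrK.
have E2 : exp_bop (- h *: Y) = 1 - h *: Y + r'.
  by rewrite /r' -scaleNr addrC [1 + _]addrC addrA !subrK.
clearbody r r'.
have -> : conj_curve Y q h - q - h *: (Y * q - q * Y) =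
    exp_bop (h *: Y) * q * r' + r * q * (1 - h *: Y) - h ^+ 2 *: (Y * q * Y).
  have S1 : h *: (Y * q - q * Y) = h *: Y * q - q * (h *: Y).
    by rewrite scalerBr bop_scalerAl bop_scalerAr.
  have S2 : h ^+ 2 *: (Y * q * Y) = h *: Y * q * (h *: Y).
    by rewrite -!bop_scalerAl -bop_scalerAr scalerA.
  by have := conj_expand (h *: Y) q r r'; rewrite S1 S2 -E1 -E2.
have q0 : 0 <= `|q| by []. have e0' : 0 <= expR `|Y| by exact: expR_ge0.
have nE : `|exp_bop (h *: Y)| <= 1 by exact: exp_norm_le1.
have b1 : `|exp_bop (h *: Y) * q * r'| <= expR `|Y| * `|q| * h ^+ 2.
  rewrite (le_trans (bop_normM _ _))// [leRHS]mulrAC [leLHS]mulrC ler_pM//.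
  by rewrite (le_trans (bop_normM _ _))// ler_piMl.
have b2 : `|r * q * (1 - h *: Y)| <= expR `|Y| * `|q| * (1 + `|Y|) * h ^+ 2.
  rewrite (le_trans (bop_normM _ _))// [leRHS]mulrAC ler_pM//.
    by rewrite (le_trans (bop_normM _ _))// [leRHS]mulrAC ler_pM.
  rewrite (le_trans (ler_normB _ _))// lerD ?bop_norm1//.
  by rewrite normrZ ler_piMl.
have b3 : `|h ^+ 2 *: (Y * q * Y)| <= `|Y| ^+ 2 * `|q| * h ^+ 2.
  rewrite normrZ ger0_norm ?sqr_ge0// mulrC ler_wpM2r ?sqr_ge0//.
  rewrite (le_trans (bop_normM _ _))// expr2 mulrAC ler_wpM2r//.
  by rewrite bop_normM.
rewrite (le_trans (ler_normB _ _))// mulrDl lerD//.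
rewrite (le_trans (ler_normD _ _))// (le_trans (lerD b1 b2))//.
by rewrite le_eqVlt; apply/orP; left; apply/eqP; ring.
Qed.

Lemma conj_curve_derive Y q t : is_adjoint Y (- Y) ->
  is_derive t (1 : R) (conj_curve Y q) (Y * conj_curve Y q t - conj_curve Y q t * Y).
Proof.
move=> aY; apply: is_derive_quadratic => h h1; rewrite conj_curveD.
exact: conj_curve_taylor.
Qed.

Lemma conj_curve_cts Y q : continuous (conj_curve Y q).
Proof.
move=> t; apply: bop_cvgM; first apply: bop_cvgM; [|exact: cvg_cst|].
  exact: exp_bop_cts.
apply: (continuous_comp (g := fun s => exp_bop (s *: Y))).
  exact: oppr_continuous.
exact: exp_bop_cts.
Qed.

Lemma conj_curve0 Y q : conj_curve Y q 0 = q.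
Proof. by rewrite /conj_curve oppr0 scale0r exp_bop0 mul1r mulr1. Qed.

Lemma conj_curve_piecewise_C1 Y q : is_adjoint Y (- Y) ->
  piecewise_C1 (conj_curve Y q).
Proof.
move=> aY; split; first exact/continuous_subspaceT/conj_curve_cts.
exists [:: 1]; first by rewrite /itv_partition/= ltr01 eqxx.
move=> [|i]//= _.
exists (fun t => Y * conj_curve Y q t - conj_curve Y q t * Y).
  apply: continuous_subspaceT => t; have ct := @conj_curve_cts Y q t.
  by apply: cvgB; apply: bop_cvgM => //; exact: cvg_cst.
by move=> t _; exact: conj_curve_derive.
Qed.

Lemma conj_unitary_norm (E F A : bop K) : is_adjoint E F -> E * F = 1 -> F * E = 1 ->
  `|E * A * F| = `|A|.
Proof.
move=> aE EF FE.
have nE := unitary_norm_le1 aE FE; have nF := unitary_norm_le1 (adjC aE) EF.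
have le (C D B : bop K) : `|C| <= 1 -> `|D| <= 1 -> `|C * B * D| <= `|B|.
  move=> C1 D1; rewrite (le_trans (bop_normM _ _))//.
  rewrite (le_trans (ler_wpM2l _ D1))// mulr1 (le_trans (bop_normM _ _))//.
  by rewrite ler_piMl.
apply/eqP; rewrite eq_le le//=.
have {1}-> : A = F * (E * A * F) * E.
  by rewrite !mulrA FE mul1r -mulrA FE mulr1.
exact: le.
Qed.

Lemma conj_curve_speed Y q t : is_adjoint Y (- Y) ->
  `|derive1 (conj_curve Y q) t| = `|Y * q - q * Y|.
Proof.
move=> aY; rewrite derive1E (derive_val (is_derive := conj_curve_derive q t aY)).
rewrite -[RHS](conj_unitary_norm _ (exp_unitary t aY) (exp_bopMN Y t) (exp_bopNM Y t)).
congr (`| _ |); rewrite mulrBr mulrBl /conj_curve !mulrA.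
have YE s : exp_bop (s *: Y) * Y = Y * exp_bop (s *: Y).
  by apply/esym/exp_bop_intertwine; rewrite -bop_scalerAr -bop_scalerAl.
by rewrite YE -[_ * Y * exp_bop (- t *: Y)]mulrA -(YE (- t)) !mulrA.
Qed.

(* The speed is constant since conjugation by a unitary is isometric. *)
Lemma conj_curve_length Y q : is_adjoint Y (- Y) ->
  curve_length (conj_curve Y q) = `|Y * q - q * Y|%:E.
Proof.
move=> aY; rewrite /curve_length.
under eq_integral do rewrite conj_curve_speed//.
rewrite integral_cst//= lebesgue_measure_itv/= lte01 oppr0 adde0 mule1.
by [].
Qed.

Lemma riemann_sphere_conj (E F q : bop K) : is_adjoint E F -> E * F = 1 ->
  F * E = 1 -> riemann_sphere q -> riemann_sphere (E * q * F).
Proof.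
move=> aE EF FE [U [Us [aU UUs UsU ->]]]; exists (E * U), (Us * F); split.
- exact: adjM.
- rewrite comp_bopE mulrA -[E * U * Us]mulrA; have -> : U * Us = 1 by [].
  by rewrite mulr1 EF.
- rewrite comp_bopE mulrA -[Us * F * E]mulrA FE mulr1.
  exact: UsU.
- by rewrite !comp_bopE !mulrA.
Qed.

Lemma riemann_sphere_p0 : riemann_sphere (@p0 R H).
Proof.
by exists id_bop, id_bop; split; [exact: is_adjoint_id|exact/bop_ext..].
Qed.

Lemma finsler_dist_conj Y q : is_adjoint Y (- Y) -> riemann_sphere q ->
  (finsler_dist q (conj_curve Y q 1) <= `|Y * q - q * Y|%:E)%E.
Proof.
move=> aY Rq; rewrite -conj_curve_length//; apply: ereal_inf_lbound.
exists (conj_curve Y q) => //; split.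
- exact: conj_curve_piecewise_C1.
- move=> t _; apply: riemann_sphere_conj => //.
  + exact: exp_unitary.
  + exact: exp_bopMN.
  + exact: exp_bopNM.
- exact: conj_curve0.
- by [].
Qed.

Lemma finsler_dist_ge0 (p q : bop K) : (0 <= finsler_dist p q)%E.
Proof.
apply: le_ereal_inf_tmp => _ [g _ <-]; apply: integral_ge0 => t _.
by rewrite lee_fin.
Qed.

(** The remaining arc from [t] to 1, run with generator [(1 - t) Y] over [[0, 1]], is a competitor
    of length at most [2 (1 - t) |Y|]. An upper bound on the distance is all that the limit
    requires. *)
Lemma great_circle_finsler_lim Y (pt : R -> bop K) : is_adjoint Y (- Y) ->
  (forall t, 0 <= t < 1 -> pt t = great_circle Y t) ->
  finsler_lim_left pt 1 (great_circle Y 1).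
Proof.
move=> aY ptE.
have sphere t : riemann_sphere (great_circle Y t).
  apply: riemann_sphere_conj riemann_sphere_p0.
  - exact: exp_unitary.
  - exact: exp_bopMN.
  - exact: exp_bopNM.
split=> //.
pose C := `|Y| * 2.
apply: (@squeeze_cvge _ _ _ _ (fun=> 0%E) _ (fun t => ((1 - t) * C)%:E)).
- near=> t; rewrite finsler_dist_ge0/=.
  have t1 : t < 1 by near: t; exact: nbhs_left_lt.
  have t1' : 0 <= 1 - t by rewrite subr_ge0 ltW.
  have t0 : 0 <= t by near: t; apply: nbhs_left_ge; exact: ltr01.
  rewrite ptE ?t0//; set q := great_circle Y t.
  have aY' : is_adjoint ((1 - t) *: Y) (- ((1 - t) *: Y)).
    by rewrite -scalerN; exact: adjZ.
  have -> : great_circle Y 1 = conj_curve ((1 - t) *: Y) q 1.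
    have -> : conj_curve ((1 - t) *: Y) q 1 = conj_curve Y q (1 - t).
      by rewrite /conj_curve !scalerA mul1r mulN1r.
    by rewrite -conj_curveD addrC subrK.
  rewrite (le_trans (finsler_dist_conj aY' (sphere t)))// lee_fin.
  have q1 : `|q| <= 1.
    rewrite (@conj_unitary_norm _ _ p0 (exp_unitary t aY) (exp_bopMN Y t) (exp_bopNM Y t)).
    apply: bop_norm_le => // z; rewrite mul1r p0E hnorm_emb1.
    rewrite -(@ler_pXn2r _ 2) ?nnegrE ?hnorm_ge0// [leRHS]hnorm_hsum.
    by rewrite lerDl sqr_ge0.
  rewrite -bop_scalerAl -bop_scalerAr -scalerBr normrZ ger0_norm//.
  rewrite ler_wpM2l// (le_trans (ler_normB _ _))// /C.
  have := bop_normM Y q; have := bop_normM q Y.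
  have : `|Y| * `|q| <= `|Y| by rewrite ler_piMr.
  by rewrite [`|q| * _]mulrC; lra.
- exact: cvg_cst.
- apply/fine_cvgP; split; first exact: nearW.
  rewrite -[X in _ --> X](_ : (1 - 1) * C = 0); last by rewrite subrr mul0r.
  apply: cvgM; last exact: cvg_cst.
  apply: cvgB; first exact: cvg_cst.
  exact: cvg_within.
Unshelve. all: by end_near. Qed.

End finsler_length.

(** * Geodesics through graphs of bounded operators *)

Section graphs_along_a_geodesic.
Context {R : realType} {H : hilbertType R}.
Local Notation K := (hsum H H).
Implicit Types (Y Z : bop K) (A : bop H) (t s : R).
Local Notation half := (2^-1 : R).

Lemma op_cos_rdot_cts Y (x y : K) : continuous (fun t => rdot (op_cos Y t x) y).
Proof. by move=> t; apply: bop_cvg_rdot; exact: op_cos_cts. Qed.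

(* For [0 <= t < 1] nonnegativity, a closed condition, is equivalent to
   coercivity, an open one. *)
Lemma op_cos_path Y : is_adjoint Y (- Y) ->
  (forall t, 0 <= t < 1 ->
    exists2 d, 0 < d & forall x, d * hnorm x ^+ 2 <= hnorm (op_cos Y t x) ^+ 2) ->
  forall t, 0 <= t <= 1 -> pos (op_cos Y t).
Proof.
move=> aY lb.
have half_open t : 0 <= t < 1 -> pos (op_cos Y t).
  pose I : set R := `[0, 1[%classic; pose B := I `&` [set t | pos (op_cos Y t)].
  suff BE : B = I by move=> t01; have [] : B t by rewrite BE /I /= in_itv.
  have /connected_intervalP cI : is_interval I by exact: interval_is_interval.
  apply: cI.
  - exists 0; split; first by rewrite /I /= in_itv/= lexx ltr01.
    by rewrite /= op_cos0 => x; exact: rdotxx_ge0.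
  - exists [set t | coercive (op_cos Y t)].
      rewrite openE => s [d d0 cd]; rewrite /interior.
      have d2 : 0 < d / 2 by rewrite divr_gt0.
      have near_s : \forall r \near s, `|op_cos Y r - op_cos Y s| <= d / 2.
        exact: (@cvgr_distC_le _ _ _ (nbhs s) _ (op_cos Y) _ (@op_cos_cts _ _ Y s) _ d2).
      apply: filterS near_s => r sr.
      exists (d / 2) => // x.
      have := cd x; have := rdot_bop_le (op_cos Y s - op_cos Y r) x.
      rewrite bopB rdotBl.
      have : `|op_cos Y s - op_cos Y r| * hnorm x ^+ 2 <= d / 2 * hnorm x ^+ 2.
        by apply: ler_wpM2r; [exact: sqr_ge0|rewrite distrC; exact: sr].
      move: (rdot (op_cos Y s x) x) (rdot (op_cos Y r x) x) (hnorm x ^+ 2).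
      by move: `|op_cos Y s - op_cos Y r| => *; lra.
    apply/seteqP; split=> s [s01 ps]; split=> //; last exact: coercive_pos.
    have s01' : 0 <= s < 1 by move: s01; rewrite /I /= in_itv.
    (* Once [0 <= C <= 1], [|C x|^2 <= <C x, x>], so the lower bound on norms becomes one on the
       form. *)
    have [d d0 ld] := lb s s01'; exists d => // x; rewrite (le_trans (ld x))//.
    have := form_bound_norm ler01 (op_cos_adj aY s) ps (op_cos_le aY s) x.
    by rewrite mul1r.
  - exists [set t | pos (op_cos Y t)] => //.
    rewrite (_ : [set t | _] = \bigcap_(x in [set: K])
        ((fun t => rdot (op_cos Y t x) x) @^-1` [set r | 0 <= r])).
      apply: closed_bigI => x _; apply: preimage_closed; last exact: closed_ge.
      by move=> s _; exact: op_cos_rdot_cts.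
    by apply/seteqP; split=> s ps x; [move=> _|]; exact: ps.
move=> t /andP[t0]; rewrite le_eqVlt => /predU1P[->|t1]; last first.
  by apply: half_open; rewrite t0.
apply: (@pos_lim _ _ _ (1 : R)^'- _ (op_cos Y)).
  near=> s; apply: half_open.
  apply/andP; split; last by near: s; exact: nbhs_left_lt.
  by near: s; apply: nbhs_left_ge; exact: ltr01.
by apply: cvg_at_left_filter; exact: op_cos_cts.
Unshelve. all: by end_near. Qed.

(** [C z + S z] and [C z - S z] are the images of [z] under the unitaries [exp (t Y)] and
    [exp (- t Y)]; average their squared norms. *)
Lemma op_cos_sin_sqr Y t (z : K) : is_adjoint Y (- Y) ->
  hnorm (op_cos Y t z) ^+ 2 + hnorm (op_sin Y t z) ^+ 2 = hnorm z ^+ 2.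
Proof.
move=> aY.
have E1 : hnorm (op_cos Y t z + op_sin Y t z) ^+ 2 = hnorm z ^+ 2.
  by rewrite -bopD -exp_cos_sin (unitary_norm (exp_unitary t aY) (exp_bopNM Y t)).
have E2 : hnorm (op_cos Y t z - op_sin Y t z) ^+ 2 = hnorm z ^+ 2.
  have aY' := exp_unitary (- t) aY; rewrite opprK in aY'.
  rewrite -bopB (_ : op_cos Y t - op_sin Y t = exp_bop (- t *: Y)).
    by rewrite (unitary_norm aY' (exp_bopMN Y t)).
  rewrite /op_cos /op_sin -scalerBr opprB [exp_bop (- t *: Y) - _]addrC.
  by rewrite addrACA subrr add0r halfD.
move: E1 E2; rewrite hnormD_sqr hnormB_sqr.
move: (hnorm (op_cos Y t z) ^+ 2) (hnorm (op_sin Y t z) ^+ 2) (hnorm z ^+ 2).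
by move: (rdot _ _) => a b c d; lra.
Qed.

Lemma op_sin_adj Y t : is_adjoint Y (- Y) -> is_adjoint (op_sin Y t) (- op_sin Y t).
Proof.
move=> aY; rewrite /op_sin -scalerN opprB; apply: adjZ; apply: adjB.
  exact: exp_unitary.
by have := exp_unitary (- t) aY; rewrite opprK.
Qed.

(** On the first summand the graph relation reads [A (C h) = S h]; with [|C h|^2 + |S h|^2 = |h|^2]
    this gives [|S h|^2 <= q |h|^2] for [q = 1 - 1 / (|A|^2 + 1)]. Keeping the sine away from 1 on
    both summands keeps the cosine away from 0. *)
Lemma graph_op_cos_bound Y t A : is_adjoint Y (- Y) -> eps0 * Y * eps0 = - Y ->
  range (great_circle Y t) = graph A ->
  exists2 d, 0 < d & forall z, d * hnorm z ^+ 2 <= hnorm (op_cos Y t z) ^+ 2.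
Proof.
move=> aY eY gA; pose M := `|A| ^+ 2 + 1; have M0 : 0 < M by rewrite ltr_wpDl ?sqr_ge0.
pose q := 1 - M^-1.
have q0 : 0 <= q by rewrite subr_ge0 invf_le1// lerDr sqr_ge0.
have sin1 h : hnorm (op_sin Y t (emb1 h)) ^+ 2 <= q * hnorm h ^+ 2.
  have [k _ e] : graph A ((op_cos Y t (emb1 h)).1, (op_sin Y t (emb1 h)).2).
    by rewrite -gA great_circle_range; exists h => //; rewrite exp_emb1.
  have kE : k = (op_cos Y t (emb1 h)).1 := congr1 fst e.
  have Ak : A k = (op_sin Y t (emb1 h)).2 := congr1 snd e.
  rewrite kE in Ak.
  have sE : hnorm (op_sin Y t (emb1 h)) ^+ 2 = hnorm (op_sin Y t (emb1 h)).2 ^+ 2.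
    by rewrite hnorm_hsum sin_emb1// hnorm0 expr0n add0r.
  have cE : hnorm (op_cos Y t (emb1 h)) ^+ 2 = hnorm (op_cos Y t (emb1 h)).1 ^+ 2.
    by rewrite (comm_emb1 _ (p0_cos eY t)) hnorm_emb1.
  have := op_cos_sin_sqr t (emb1 h) aY; rewrite hnorm_emb1 cE sE -Ak.
  set c := (op_cos Y t (emb1 h)).1 => <-.
  have : hnorm (A c) ^+ 2 <= (M - 1) * hnorm c ^+ 2.
    rewrite /M addrK -exprMn ler_pXn2r ?nnegrE ?mulr_ge0 ?hnorm_ge0//.
    exact: hnorm_bop.
  rewrite /q mulrBl mul1r; move: (hnorm (A c) ^+ 2) (hnorm c ^+ 2) => a b ab.
  suff : M^-1 * (b + a) <= b by lra.
  by rewrite ler_pdivrMl//; lra.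
(* The off-diagonal blocks of the skew operator [op_sin] are adjoint to each other up to sign, so
   the bound carries over by duality. *)
have sin2 (k : H) : hnorm (op_sin Y t ((0, k) : K)) ^+ 2 <= q * hnorm k ^+ 2.
  set w : K := (0, k); pose l := (op_sin Y t w).1.
  have wl : op_sin Y t w = emb1 l.
    rewrite /l -p0E -bopM p0_sin// bopM bopB bop1 (_ : p0 w = 0) ?subr0//.
  have : rdot (op_sin Y t w) (emb1 l) = - rdot w (op_sin Y t (emb1 l)).
    by have /is_adjointP -> := op_sin_adj t aY; rewrite bopN rdotNr.
  have wE v : rdot w v = rdot k v.2 by rewrite rdot_hsum rdot0l add0r.
  rewrite wl rdotxx hnorm_emb1 wE => E.
  have h1 : hnorm l ^+ 2 <= hnorm k * hnorm (op_sin Y t (emb1 l)).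
    rewrite E (le_trans (ler_norm _))// normrN (le_trans (rdot_CS _ _))//.
    by rewrite ler_wpM2l ?hnorm_ge0// hnorm_snd.
  have := sin1 l; set S := hnorm (op_sin Y t (emb1 l)) in h1 *.
  have S0 : 0 <= S by exact: hnorm_ge0.
  move=> h2; have [->|lN0] := eqVneq (hnorm l) 0.
    by rewrite expr0n mulr_ge0 ?sqr_ge0.
  have l0 : 0 < hnorm l ^+ 2 by rewrite exprn_gt0// lt_neqAle eq_sym lN0 hnorm_ge0.
  rewrite -(ler_pM2r l0) (@le_trans _ _ (hnorm k ^+ 2 * S ^+ 2))//.
    by rewrite -expr2 -exprMn ler_pXn2r ?nnegrE ?mulr_ge0 ?hnorm_ge0 ?sqr_ge0.
  by rewrite [leRHS]mulrAC [leLHS]mulrC ler_wpM2r ?sqr_ge0.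
exists M^-1 => [|[h k]]; first by rewrite invr_gt0.
have zE : (h, k) = emb1 h + ((0, k) : K) :> K by congr pair; rewrite /= ?addr0 ?add0r.
have := op_cos_sin_sqr t ((h, k) : K) aY.
suff : hnorm (op_sin Y t ((h, k) : K)) ^+ 2 <= q * hnorm ((h, k) : K) ^+ 2.
  move: (hnorm (op_cos Y t (h, k)) ^+ 2) (hnorm (op_sin Y t (h, k)) ^+ 2).
  move: (hnorm ((h, k) : K) ^+ 2) => a b c; rewrite /q mulrBl mul1r; lra.
rewrite [X in _ * X]hnorm_hsum mulrDr.
have -> : op_sin Y t ((h, k) : K) = op_sin Y t (emb1 h) + op_sin Y t ((0, k) : K).
  by rewrite zE linearD.
rewrite hnormD_sqr.
have -> : rdot (op_sin Y t (emb1 h)) (op_sin Y t ((0, k) : K)) = 0.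
  rewrite rdot_hsum sin_emb1// rdot0l add0r.
  have -> : op_sin Y t ((0, k) : K) = emb1 (op_sin Y t ((0, k) : K)).1.
    by rewrite -p0E -bopM p0_sin// bopM bopB bop1 (_ : p0 _ = 0) ?subr0.
  by rewrite rdot0r.
rewrite mul0rn addr0; apply: lerD; [exact: sin1|exact: sin2].
Qed.

(** Time 0 forces the base point to be [p0]. Tangency gives [p0 X p0 = 0], whence [eps0 Y = - X] and
    [X eps0 = Y] for [Y = X p0 - p0 X]. *)
Lemma geodesic_from_p0 (pt : R -> bop K) : is_geodesic pt -> pt 0 = p0 ->
  exists Y, [/\ is_adjoint Y (- Y), eps0 * Y * eps0 = - Y &
    forall t, 0 <= t <= 1 -> pt t = great_circle Y t].
Proof.
case=> p [X [_ [sX Xp ptE]]] pt0.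
have pE : p = p0.
  rewrite -pt0 ptE; last by rewrite in_itv/= lexx ler01.
  by rewrite /= oppr0 !scale0r exp_bop0 !comp_bopE mul1r mulr1.
rewrite {}pE in Xp ptE; have {}Xp : X * p0 + p0 * X = X by [].
pose Y := X * p0 - p0 * X; exists Y; split.
- rewrite opprB; apply: adjB; first exact: adjM sX p0_adj.
  exact: adjM p0_adj sX.
- have pXp : p0 * X * p0 = 0.
    have := congr1 (fun B : bop K => p0 * B) Xp; rewrite mulrDr !mulrA p0_sqr.
    by move/eqP; rewrite -subr_eq0 addrK => /eqP.
  have eE (A : bop K) : eps0 * A = p0 * A + p0 * A - A.
    by rewrite /eps0 /symmetry_of scaler_nat mulr2n mulrBl mul1r mulrDl.
  have Ee (A : bop K) : A * eps0 = A * p0 + A * p0 - A.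
    by rewrite /eps0 /symmetry_of scaler_nat mulr2n mulrBr mulr1 mulrDr.
  have -> : eps0 * Y = - X.
    rewrite eE /Y !mulrBr !mulrA p0_sqr pXp sub0r opprB addrA subrK.
    by rewrite -[X in RHS]Xp opprD addrC.
  rewrite mulNr Ee; congr (- _).
  transitivity (X * p0 + X * p0 - (X * p0 + p0 * X)); first by rewrite Xp.
  by rewrite addrDBl.
- by move=> t t01; rewrite ptE ?in_itv.
Qed.

(** A kernel vector satisfies [p0 z + P z = z], so [P z = (0, z.2)] lies in the graph and
    [z.2 = T 0 = 0]. Then [P z = 0], so [z.1] is orthogonal to the dense domain. *)
Lemma injective_op_graph (T : operator H) (P : bop K) :
  dense (dom T) -> is_orthoproj (graph T) P -> injective_op (eps0 + symmetry_of P).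
Proof.
move=> dT PT z; have [PP sP rP] := PT.
rewrite bopD => /eqP; rewrite /eps0 /symmetry_of !bopB !bopZ !bop1 addrACA -opprD.
rewrite subr_eq0 -scalerDr => /eqP.
have two : (z + z : K) = (2%:C)%C *: z.
  by rewrite rmorph_nat scaler_nat mulr2n.
rewrite two => /(congr1 (fun v => (2^-1%:C)%C *: v)).
have c1 : ((2^-1)%:C * 2%:C)%C = 1 :> R[i] by rewrite -rmorphM/= mulVf.
rewrite !scalerA c1 !scale1r => pPz.
have Pz : P z = ((0, z.2) : K).
  have -> : P z = z - p0 z by apply/eqP; rewrite eq_sym subr_eq addrC pPz.
  by case: (z) => h k; congr pair; rewrite /= ?subrr ?subr0.
have z2 : z.2 = 0.
  have [h _ [h0 Th]] : graph T ((0, z.2) : K) by rewrite -rP -Pz; exists z.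
  have [k _ [k0 Tk]] := @graph0 _ _ T.
  by rewrite -Th h0 -[X in T X]k0.
have Pz0 : P z = 0 by rewrite Pz z2.
have ortho h : dom T h -> rdot z.1 h = 0.
  move=> dh; have g : graph T ((h, T h) : K) by exists h.
  have := orthoproj_fix PT g => Pg.
  have : rdot (P z) ((h, T h) : K) = 0 by rewrite Pz0 rdot0l.
  have /is_adjointP -> := sP.
  by rewrite Pg rdot_hsum/= z2 rdot0l addr0.
suff z1 : z.1 = 0 by case: (z) z1 z2 => a b /= -> ->.
apply/eqP/negPn/negP => zN0.
have nz : 0 < hnorm z.1.
  by rewrite lt_neqAle hnorm_ge0 andbT eq_sym; apply: contra_neq zN0 => /hnorm0_eq0.
have nzC : (0 : R[i]) < (hnorm z.1)%:C%C by rewrite ltcR.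
(* A vector [h] orthogonal to [z.1] has [|z.1 - h| >= |z.1|], so this ball misses the domain. *)
have [||h [zh dh]] := dT (ball z.1 (hnorm z.1)%:C%C).
- by exists z.1; exact: ballxx.
- exact: ball_open.
move: zh; rewrite -ball_normE/= hnormE ltcR ltNge => /negP; apply.
rewrite -(@ler_pXn2r _ 2) ?nnegrE ?hnorm_ge0// hnormB_sqr ortho//.
by rewrite mul0rn subr0 lerDl sqr_ge0.
Qed.

End graphs_along_a_geodesic.

(** * The canonical deformation *)

Section deformation.
Context {R : realType} {H : hilbertType R}.
Local Notation K := (hsum H H).
Context (Y : bop K) (aY : is_adjoint Y (- Y)) (eY : eps0 * Y * eps0 = - Y).
Context (G : R -> bop K).
Context (GP : forall t, 0 <= t < 1 -> op_cos Y t * G t = 1 /\ G t * op_cos Y t = 1).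

(** The tangent vector at [p0] is [Y * eps0], inverting the relation [X eps0 = Y] found for
    geodesics from [p0]. *)
Lemma great_circle_geodesic : is_geodesic (great_circle Y).
Proof.
have Ye : eps0 * Y = - Y * eps0 by rewrite -eY -[RHS]mulrA eps0_sqr mulr1.
have ep : eps0 * p0 = p0 :> bop K.
  by rewrite /eps0 /symmetry_of mulrBl mul1r -bop_scalerAl p0_sqr scaler_nat mulr2n addrK.
have pe : p0 * eps0 = p0 :> bop K.
  by rewrite /eps0 /symmetry_of mulrBr mulr1 -bop_scalerAr p0_sqr scaler_nat mulr2n addrK.
have pY : p0 * Y = Y * (1 - p0) by apply: p0_anticomm; rewrite Ye mulNr.
have X1 : Y * eps0 * p0 = Y * p0 by rewrite -mulrA ep.
have X2 : p0 * (Y * eps0) = Y * eps0 - Y * p0.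
  by rewrite mulrA pY -mulrA mulrBl mul1r pe mulrBr.
exists p0, (Y * eps0); split; first exact: riemann_sphere_p0.
- split; last by rewrite !comp_bopE X1 X2 addrC subrK.
  by rewrite -[X in is_adjoint _ X]opprK -mulNr -Ye -mulrN; exact: adjM aY eps0_adj.
- move=> t _ /=; rewrite !comp_bopE X1 X2.
  suff -> : Y * p0 - (Y * eps0 - Y * p0) = Y by [].
  rewrite opprB addrA -mulrDr -mulrBr.
  have -> : p0 + p0 - eps0 = 1 :> bop K.
    by rewrite /eps0 /symmetry_of scaler_nat mulr2n opprB addrCA subrr addr0.
  by rewrite mulr1.
Qed.

(** [G] is chosen pointwise, yet inverses vary continuously: [G s - G t = - G s (C s - C t) G t],
    where [C] is the cosine, and [|G s| <= 2 |G t|] once [|C s - C t| |G t| <= 1 / 2]. *)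
Lemma tangent_op_cts : {within `[0, 1[, continuous (fun t => tangent_op Y t (G t))}.
Proof.
suff Gc : {within `[0, 1[, continuous G}.
  apply/subspace_continuousP => t t01.
  have SG : (fun s => op_sin Y s * G s) @ within `[0, 1[ (nbhs t) --> op_sin Y t * G t.
    apply: bop_cvgM; last by move/subspace_continuousP : Gc; exact.
    by apply: cvg_within_filter; exact: op_sin_cts.
  apply/subr_cvg0/norm_cvg0P.
  apply: (@squeeze_cvgr _ _ _ _ (fun=> 0)
    (fun s => `|op_sin Y s * G s - op_sin Y t * G t|)).
  - by near=> s; rewrite normr_ge0/= /tangent_op compressB compress_norm.
  - exact: cvg_cst.
  - exact/norm_cvg0P/subr_cvg0.
apply/subspace_continuousP => t; rewrite /= in_itv/= => t01.
have [CG GC] := GP t01; pose g := `|G t|; pose C s := `|op_cos Y s - op_cos Y t|.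
have C0 : C s @[s --> within `[0, 1[ (nbhs t)] --> (0 : R).
  apply/norm_cvg0P/subr_cvg0; apply: cvg_within_filter; exact: op_cos_cts.
have g0 : 0 <= g by exact: normr_ge0.
have C_ge0 s : 0 <= C s by exact: normr_ge0.
(* This radius makes the cosine variation times [g] at most [1 / 2]; the [+ 1] avoids dividing by
   0. *)
have r0 : 0 < (2 * (g + 1))^-1 by rewrite invr_gt0 mulr_gt0// ltr_wpDl.
apply/subr_cvg0/norm_cvg0P.
apply: (@squeeze_cvgr _ _ _ _ (fun=> 0) (fun s => 2 * g ^+ 2 * C s)).
- near=> s; rewrite normr_ge0/=.
  have s01 : 0 <= s < 1.
    have : s \in `[0, 1[ by near: s; exact: withinT.
    by rewrite in_itv.
  have [CGs GCs] := GP s01.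
  have Cs : C s * g <= 2^-1.
    have : `|C s| < (2 * (g + 1))^-1 by near: s; exact: cvgr0_norm_lt C0 _ r0.
    rewrite ger0_norm// -[X in _ < X]mul1r ltr_pdivlMr ?mulr_gt0 ?ltr_wpDl//.
    by have := C_ge0 s; move: (C s) => b; nra.
  have dG : G s - G t = - (G s * (op_cos Y s - op_cos Y t) * G t).
    by rewrite mulrBr GCs mulrBl mul1r -mulrA CG mulr1 opprB.
  have n1 : `|G s - G t| <= `|G s| * C s * g.
    rewrite dG normrN (le_trans (bop_normM _ _))// ler_wpM2r//.
    exact: bop_normM.
  have n2 : `|G s| <= g + `|G s - G t|.
    by rewrite -[X in `|X| <= _](subrK (G t)) addrC ler_normD.
  move: n1 n2 Cs g0 (C_ge0 s) (normr_ge0 (G s)).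
  move: `|G s - G t| `|G s| (C s) => a b c ab ba cg g_ge0 c_ge0 b_ge0.
  have b_le : b <= 2 * g by nra.
  have cg0 : 0 <= c * g by rewrite mulr_ge0.
  by nra.
- exact: cvg_cst.
- have h : (fun s => 2 * g ^+ 2 * C s) @ within `[0, 1[ (nbhs t) --> 2 * g ^+ 2 * 0.
    by apply: cvgM; [exact: cvg_cst|exact: C0].
  by rewrite mulr0 in h.
Unshelve. all: by end_near. Qed.

Lemma proj_graph_tangent_op t : 0 <= t < 1 ->
  proj_graph (tangent_op Y t (G t)) = great_circle Y t.
Proof.
by move=> /GP[CG GC]; apply: proj_graphE; exact: great_circle_orthoproj.
Qed.

End deformation.

Theorem corollary5p12 (R : realType) (H : hilbertType R) (T : operator H)
    (T_dense : dense (dom T)) (T_closed : closed (graph T))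
    (T_unbounded : ~ bounded_op T) :
  exists_unique_on `[0, 1[ (fun Tt : R -> bop H =>
    bounded_deformation 1 T Tt /\
    exists pt : R -> bop (hsum H H),
      [/\ deformation_curve 1 Tt pt,
          Tt 0 = 0,
          is_geodesic pt &
          pt 1 = proj_graph T]).
Proof.
set P := proj_graph T; have PT : is_orthoproj (graph T) P by exact: proj_graphP.
have [PP sP _] := PT; have inj := injective_op_graph T_dense PT.
(* The endpoint is prescribed as a projection, whereas generators are characterized through
   symmetries. *)
have endpoint (Z : bop (hsum H H)) : great_circle Z 1 = P <->
    exp_bop (1 *: Z) * eps0 * exp_bop (- 1 *: Z) = symmetry_of P.
  rewrite -(symmetry_conj _ (exp_bopMN Z 1)).
  by split=> [<-|/symmetry_inj].
have [Y [aY eY /endpoint Y1 pY]] :=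
  geodesic_generator_exists eps0_adj eps0_sqr (symmetry_adj sP) (symmetry_sqr PP) inj.
have /choice[G GP] : forall t, exists B, 0 <= t < 1 ->
    op_cos Y t * B = 1 /\ B * op_cos Y t = 1.
  move=> t; have [t01|nt] := boolP (0 <= t < 1); last by exists 0.
  have [B BP] := coercive_inv (op_cos_adj aY t) (op_cos_coercive aY pY t01).
  by exists B.
pose f t := tangent_op Y t (G t).
have fE t : 0 <= t < 1 -> proj_graph (f t) = great_circle Y t.
  exact: proj_graph_tangent_op.
have flim : finsler_lim_left (fun t => proj_graph (f t)) 1 P.
  by rewrite -Y1; exact: great_circle_finsler_lim.
exists f.
  split; first by split; [exact: ltr01|exact: tangent_op_cts|].
  exists (great_circle Y); split.
  - split; last by rewrite Y1.
    by move=> t; rewrite in_itv/= => /fE.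
  - by rewrite /f /tangent_op op_sin0 mul0r compress0.
  - exact: great_circle_geodesic.
  - exact: Y1.
move=> g [_ [pt [[ptE _] g0 gpt pt1]]] t; rewrite /= in_itv/= => t01.
have pt0 : pt 0 = p0.
  by rewrite ptE ?in_itv/= ?lexx ?ltr01// g0 proj_graph0.
have [Z [aZ eZ ptZ]] := geodesic_from_p0 gpt pt0.
have gZ s : 0 <= s < 1 -> proj_graph (g s) = great_circle Z s.
  move=> /andP[s0 s1]; rewrite -ptZ ?s0 ?ltW//; apply/esym/ptE.
  by rewrite in_itv/= s0.
have posZ : forall s, 0 <= s <= 1 -> pos (op_cos Z s).
  apply: op_cos_path => // s s01; apply: (graph_op_cos_bound (A := g s)) => //.
  by rewrite -gZ//; have [_ _ ->] := proj_graphP (@closed_graph_bop _ _ (g s)).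
(* A bounded operator is determined by the projection onto its graph, so equal generators give equal
   families. *)
suff ZY : Z = Y by apply: proj_graph_inj; rewrite gZ// ZY fE.
have Z1 : exp_bop (1 *: Z) * eps0 * exp_bop (- 1 *: Z) = symmetry_of P.
  by apply/endpoint; rewrite -ptZ ?lexx ?ler01.
have pZ n : pos (op_cos Z ((2^-1 : R) ^+ n)).
  by apply: posZ; rewrite exprn_ge0//= exprn_ile1//; lra.
have Y1' : exp_bop (1 *: Y) * eps0 * exp_bop (- 1 *: Y) = symmetry_of P.
  exact/endpoint.
exact: (geodesic_generator_uniq eps0_sqr inj aZ eZ Z1 pZ aY eY Y1' pY).
Qed.
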